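(* Let $H$ be a cocommutative Hopf algebra over a field $k$ and let $A$ be a commutative partial $H$-module algebra. Given two partial $2$-cocycles $\omega,\sigma\in Z^2_{par}(H,A)$, the associated partial crossed products $\underline{A\#_\omega H}$ and $\underline{A\#_\sigma H}$ are isomorphic (as algebras, via an isomorphism which is also a left $A$-module and right $H$-comodule map) if, and only if, $\omega$ and $\sigma$ are cohomologous, that is, they belong to the same class in the cohomology group $H^2_{par}(H,A)$.
   Context: $k$ is a field; Sweedler notation is used. A partial action of $H$ on a unital algebra $A$ (making $A$ a partial $H$-module algebra) is a linear map $\cdot:H\otimes A\to A$ such that for all $a,b\in A$, $h,l\in H$: (PA1) $1_H\cdot a=a$; (PA2) $h\cdot(ab)=(h_{(1)}\cdot a)(h_{(2)}\cdot b)$; (PA3) $h\cdot(l\cdot a)=(h_{(1)}\cdot 1_A)(h_{(2)}l\cdot a)$. $\mathrm{Hom}_k(H^{\otimes n},A)$ is the (commutative) convolution algebra, $(f*g)(h^1,\ldots,h^n)=f(h^1_{(1)},\ldots,h^n_{(1)})\,g(h^1_{(2)},\ldots,h^n_{(2)})$. Let $e_1(h)=h\cdot1_A$ and $e_2(h,l)=h\cdot(l\cdot1_A)$ (idempotents). For $n=1,2$, $C^n_{par}(H,A)$ is the group of invertible elements of $e_n*\mathrm{Hom}_k(H^{\otimes n},A)$ with unit $e_n$. $Z^2_{par}(H,A)$ is the group of $\omega\in C^2_{par}(H,A)$ with $(h_{(1)}\cdot\omega(l_{(1)},m_{(1)}))\,\omega(h_{(2)},l_{(2)}m_{(2)})=(h_{(1)}\cdot1_A)\,\omega(h_{(2)},l_{(1)})\,\omega(h_{(3)}l_{(2)},m)$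 for all $h,l,m\in H$. $B^2_{par}(H,A)$ is the group of maps $\delta_1(f)(h,l)=(h_{(1)}\cdot f(l_{(1)}))\,f^{-1}(h_{(2)}l_{(2)})\,f(h_{(3)})$ with $f\in C^1_{par}(H,A)$, and $H^2_{par}(H,A)=Z^2_{par}(H,A)/B^2_{par}(H,A)$. For $\omega\in Z^2_{par}(H,A)$, define on $A\otimes H$ the multiplication $(a\otimes h)(b\otimes l)=a(h_{(1)}\cdot b)\,\omega(h_{(2)},l_{(1)})\otimes h_{(3)}l_{(2)}$; the partial crossed product is $\underline{A\#_\omega H}=(A\otimes H)(1_A\otimes1_H)$, spanned by the elements $a\#h=a(h_{(1)}\cdot1_A)\otimes h_{(2)}$. Its left $A$-module structure is $a(b\#h)=ab\#h$ and its right $H$-comodule structure is $\rho(a\#h)=a\#h_{(1)}\otimes h_{(2)}$. *)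

(* Defs.v *)
From HB Require Import structures.
From mathcomp Require Import all_boot all_order all_algebra.
From mathcomp Require Import boolp.
Set Implicit Arguments. Unset Strict Implicit. Unset Printing Implicit Defensive.
Import GRing.Theory.
Local Open Scope ring_scope.
Local Open Scope quotient_scope.

Notation bilinear_map f := (bilinear_for *:%R *:%R f).

Section TensorProduct.
Variables (k : fieldType) (V W : lmodType k).

Definition eval_tens (U : nmodType) (f : V -> W -> U) (s : seq (V * W)) : U :=
  \sum_(p <- s) f p.1 p.2.

(** The tensor product is realised as the quotient of the formal sums of pure
    tensors (finite sequences of pairs) identifying two sums as soon as every
    bilinear map takes the same value on both. *)
Definition tens_rel (s t : seq (V * W)) : bool :=
  `[< forall (U : lmodType k) (f : V -> W -> U),
        bilinear_map f -> eval_tens f s = eval_tens f t >].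

Fact tens_rel_equiv : equiv_class_of tens_rel.
Proof.
split=> [s|s t|t s r].
- exact/asboolP.
- by apply/asboolP/asboolP=> st U f fb; rewrite st.
- by move=> /asboolP st /asboolP tr; apply/asboolP=> U f fb; rewrite st ?tr.
Qed.
Canonical tens_rel_canonical :=
  EquivRelPack tens_rel_equiv.

Definition tens := {eq_quot tens_rel}.
HB.instance Definition _ := EqQuotient.on tens.
HB.instance Definition _ := Choice.on tens.

(** Value of [f] on a tensor, computed on a chosen representative
    [t = \sum_i v_i (x) w_i] as [\sum_i f v_i w_i]; it only has a mathematical
    meaning when [f] is bilinear ([tsum_pure], [tsum_linear]), which is the case
    at every use below. *)
Definition tsum (U : nmodType) (f : V -> W -> U) (t : tens) : U :=
  eval_tens f (repr t).

Definition tpure (v : V) (w : W) : tens := \pi_tens [:: (v, w)].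

Lemma tsum_pi (U : lmodType k) (f : V -> W -> U) s :
  bilinear_map f -> tsum f (\pi_tens s) = eval_tens f s.
Proof.
move=> fb; have /eqmodP/asboolP H : repr (\pi_tens s) = s %[mod tens].
  by rewrite reprK.
exact: H.
Qed.

Lemma tens_ext (x y : tens) :
  (forall (U : lmodType k) (f : V -> W -> U), bilinear_map f -> tsum f x = tsum f y) ->
  x = y.
Proof.
move=> H; rewrite -[x]reprK -[y]reprK; apply/eqmodP/asboolP=> U f fb.
exact: H.
Qed.

Definition tens_zero : tens := \pi_tens [::].
Definition tens_add (x y : tens) : tens := \pi_tens (repr x ++ repr y).
Definition tens_scale (a : k) (x : tens) : tens :=
  \pi [seq (a *: p.1, p.2) | p <- repr x].
Definition tens_opp x := tens_scale (-1) x.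

Section Ev.
Variables (U : lmodType k) (f : V -> W -> U) (fb : bilinear_map f).
Lemma tsum0_ : tsum f tens_zero = 0.
Proof. by rewrite tsum_pi // /eval_tens big_nil. Qed.
Lemma tsumD_ x y : tsum f (tens_add x y) = tsum f x + tsum f y.
Proof. by rewrite tsum_pi // /eval_tens big_cat. Qed.
Lemma tsumZ_ a x : tsum f (tens_scale a x) = a *: tsum f x.
Proof.
rewrite tsum_pi // /eval_tens big_map /tsum /eval_tens scaler_sumr.
apply: eq_bigr => p _ /=.
have := fb.1 p.2 a p.1 0; rewrite /= !addr0 => ->.
have := fb.1 p.2 (-1) 0 0; rewrite /= scaler0 addr0 scaleN1r addNr => ->.
by rewrite addr0.
Qed.
End Ev.

Fact tens_addA : associative tens_add.
Proof. by move=> x y z; apply: tens_ext => U f fb; rewrite !tsumD_ // addrA. Qed.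
Fact tens_addC : commutative tens_add.
Proof. by move=> x y; apply: tens_ext => U f fb; rewrite !tsumD_ // addrC. Qed.
Fact tens_add0 : left_id tens_zero tens_add.
Proof. by move=> x; apply: tens_ext => U f fb; rewrite !tsumD_ // tsum0_ // add0r. Qed.
Fact tens_addN : left_inverse tens_zero tens_opp tens_add.
Proof.
by move=> x; apply: tens_ext => U f fb; rewrite !tsumD_ // tsum0_ // tsumZ_ // scaleN1r addNr.
Qed.
HB.instance Definition _ := GRing.isZmodule.Build tens tens_addA tens_addC tens_add0 tens_addN.

Fact tens_scaleA a b x : tens_scale a (tens_scale b x) = tens_scale (a * b) x.
Proof. by apply: tens_ext => U f fb; rewrite !tsumZ_ // scalerA. Qed.
Fact tens_scale1 : left_id 1 tens_scale.
Proof. by move=> x; apply: tens_ext => U f fb; rewrite !tsumZ_ // scale1r. Qed.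
Fact tens_scaleDr : right_distributive tens_scale +%R.
Proof. by move=> a x y; apply: tens_ext => U f fb; rewrite !(tsumZ_, tsumD_) // scalerDr. Qed.
Fact tens_scaleDl x : {morph tens_scale^~ x : a b / a + b}.
Proof. by move=> a b; apply: tens_ext => U f fb; rewrite !(tsumZ_, tsumD_) // scalerDl. Qed.
HB.instance Definition _ := GRing.Zmodule_isLmodule.Build k tens
  tens_scaleA tens_scale1 tens_scaleDr tens_scaleDl.

Lemma tsum_pure (U : lmodType k) (f : V -> W -> U) v w :
  bilinear_map f -> tsum f (tpure v w) = f v w.
Proof. by move=> fb; rewrite tsum_pi // /eval_tens big_seq1. Qed.

Lemma tsum_linear (U : lmodType k) (f : V -> W -> U) :
  bilinear_map f -> linear (tsum f).
Proof. by move=> fb a x y; rewrite tsumD_ // tsumZ_. Qed.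

End TensorProduct.

Notation "v ⊗ w" := (tpure v w) (at level 40, left associativity) : ring_scope.
Notation "\tsum_ ( v , w <- t ) F" := (tsum (fun v w => F) t)
  (at level 41, v name, w name, t at level 41, F at level 41,
   format "'[' \tsum_ ( v ,  w  <-  t ) '/  '  F ']'") : ring_scope.

Section Lin.
Variable k : fieldType.
Implicit Types U V W X Y : lmodType k.

Lemma lin_id V : linear (fun u : V => u). Proof. by []. Qed.
Lemma lin_comp U V W (g : {linear V -> W}) (f : U -> V) :
  linear f -> linear (fun u => g (f u)).
Proof. by move=> lf a u v; rewrite lf linearP. Qed.
Lemma lin_app U V W (g : V -> W) (f : U -> V) :
  linear g -> linear f -> linear (fun u => g (f u)).
Proof. by move=> lg lf a u v; rewrite lf lg. Qed.
Lemma lin_scale U V (c : k) (f : U -> V) : linear f -> linear (fun u => c *: f u).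
Proof. by move=> lf a u v; rewrite lf scalerDr !scalerA mulrC. Qed.
Lemma lin_scalel U V (w : V) (f : U -> k) :
  linear (f : U -> k^o) -> linear (fun u => f u *: w).
Proof. by move=> lf a u v; rewrite lf scalerDl -scalerA. Qed.

Lemma tpureDl V W (v v' : V) (w : W) : (v + v') ⊗ w = v ⊗ w + v' ⊗ w.
Proof.
by apply: tens_ext => U f fb; rewrite tsumD_ // !tsum_pure //; have := fb.1 w 1 v v';
 rewrite /= !scale1r.
Qed.
Lemma tpureDr V W (v : V) (w w' : W) : v ⊗ (w + w') = v ⊗ w + v ⊗ w'.
Proof.
by apply: tens_ext => U f fb; rewrite tsumD_ // !tsum_pure //; have := fb.2 v 1 w w';
 rewrite /= !scale1r.
Qed.
Lemma bil0l U V W (f : V -> W -> U) w : bilinear_map f -> f 0 w = 0.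
Proof. by move=> fb; have := fb.1 w (-1) 0 0; rewrite /= scaler0 addr0 scaleN1r addNr. Qed.
Lemma bil0r U V W (f : V -> W -> U) v : bilinear_map f -> f v 0 = 0.
Proof. by move=> fb; have := fb.2 v (-1) 0 0; rewrite /= scaler0 addr0 scaleN1r addNr. Qed.

Lemma tpureZl V W a (v : V) (w : W) : (a *: v) ⊗ w = a *: (v ⊗ w).
Proof.
by apply: tens_ext => U f fb; rewrite tsumZ_ // !tsum_pure //; have := fb.1 w a v 0;
 rewrite /= (bil0l _ fb) !addr0.
Qed.
Lemma tpureZr V W a (v : V) (w : W) : v ⊗ (a *: w) = a *: (v ⊗ w).
Proof.
by apply: tens_ext => U f fb; rewrite tsumZ_ // !tsum_pure //; have := fb.2 v a w 0;
 rewrite /= (bil0r _ fb) !addr0.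
Qed.

Lemma lin_purel U V W (w : W) (f : U -> V) : linear f -> linear (fun u => f u ⊗ w).
Proof. by move=> lf a u v; rewrite lf tpureDl tpureZl. Qed.
Lemma lin_purer U V W (v : V) (f : U -> W) : linear f -> linear (fun u => v ⊗ f u).
Proof. by move=> lf a u u'; rewrite lf tpureDr tpureZr. Qed.
Lemma lin_tsumF U V W X (F : U -> V -> W -> X) t :
  (forall v w, linear (fun u => F u v w)) -> linear (fun u => tsum (F u) t).
Proof.
move=> lF a u v; rewrite /tsum /eval_tens scaler_sumr -big_split /=.
by apply: eq_bigr => p _; rewrite lF.
Qed.
Lemma lin_tsumt U V W X (F : V -> W -> X) (f : U -> tens V W) :
  bilinear_map F -> linear f -> linear (fun u => tsum F (f u)).
Proof. by move=> bF lf a u v; rewrite lf tsum_linear. Qed.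
Lemma lin_mull U (A : algType k) (f : U -> A) c : linear f -> linear (fun u => f u * c).
Proof. by move=> lf a u v; rewrite lf mulrDl scalerAl. Qed.
Lemma lin_mulr U (A : algType k) (f : U -> A) c : linear f -> linear (fun u => c * f u).
Proof. by move=> lf a u v; rewrite lf mulrDr scalerAr. Qed.

Lemma eq_tsum V W (U : nmodType) (F G : V -> W -> U) t :
  (forall v w, F v w = G v w) -> tsum F t = tsum G t.
Proof. by move=> FG; apply: eq_bigr => p _; exact: FG. Qed.

Lemma tsum_pureE V W (t : tens V W) : \tsum_(v, w <- t) (v ⊗ w) = t.
Proof.
apply: tens_ext => U f fb.
suff H s : tsum f (eval_tens (@tpure k V W) s) = eval_tens f s by exact: H.
rewrite /eval_tens; elim: s => [|p s ih]; first by rewrite !big_nil; exact: tsum0_.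
by rewrite !big_cons -ih -[f _ _]tsum_pure //; exact: tsumD_.
Qed.

Lemma tens_ind V W (X : lmodType k) (f g : tens V W -> X) :
  linear f -> linear g -> (forall v w, f (v ⊗ w) = g (v ⊗ w)) -> f =1 g.
Proof.
move=> lf lg fg t; rewrite -[t]tsum_pureE /tsum /eval_tens.
have f0 : f 0 = 0 by have := lf (-1) 0 0; rewrite scaler0 addr0 scaleN1r addNr.
have g0 : g 0 = 0 by have := lg (-1) 0 0; rewrite scaler0 addr0 scaleN1r addNr.
elim: (repr t) => [|p s ih]; first by rewrite !big_nil f0 g0.
rewrite !big_cons -[p.1 ⊗ p.2]scale1r lf lg.
by congr (_ + _); [congr (_ *: _); exact: fg | exact: ih].
Qed.

Lemma tsum_lin V W X (Y : lmodType k) (F : V -> W -> X) (g : X -> Y) t :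
  linear g -> g (tsum F t) = \tsum_(v, w <- t) g (F v w).
Proof.
move=> lg; have g0 : g 0 = 0 by have := lg (-1) 0 0; rewrite scaler0 addr0 scaleN1r addNr.
rewrite /tsum /eval_tens.
elim: (repr t) => [|p s ih]; first by rewrite !big_nil.
by rewrite !big_cons -[F _ _]scale1r lg !scale1r ih.
Qed.

Lemma exchange_tsum V W V' W' X (F : V -> W -> V' -> W' -> X) s t :
  \tsum_(a, b <- s) \tsum_(c, d <- t) F a b c d =
  \tsum_(c, d <- t) \tsum_(a, b <- s) F a b c d.
Proof. exact: exchange_big. Qed.

End Lin.

Ltac lin := lazymatch goal with
  | |- _ * _ => split=> ? /=; lin
  | |- prod _ _ => split=> ? /=; lin
  | |- bilinear_for _ _ _ => split=> ? /=; lin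
  | |- GRing.linear_for _ _ => first
    [ solve [auto] | exact: lin_id | exact: linearP
    | apply: lin_mull; lin | apply: lin_mulr; lin
    | apply: lin_purel; lin | apply: lin_purer; lin
    | apply: lin_scalel; lin | apply: lin_scale; lin
    | apply: lin_tsumF => ? ?; lin
    | apply: lin_tsumt; lin
    | apply: lin_comp; lin
    ]
  | |- _ => idtac
  end.

(** Sweedler notation: [\tsum_(h1, h2 <- comul h) F h1 h2] stands for
    [F h_(1) h_(2)]; three legs are obtained by nesting. *)
HB.mixin Record isCoalgebra (k : fieldType) C of GRing.Lmodule k C := {
  comul : C -> tens C C;
  counit : C -> k;
  comul_linear : linear comul;
  counit_linear : linear (counit : C -> k^o);
  comulA : forall c,
    \tsum_(x, c3 <- comul c) \tsum_(c1, c2 <- comul x) (c1 ⊗ (c2 ⊗ c3)) =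
    \tsum_(c1, x <- comul c) \tsum_(c2, c3 <- comul x) (c1 ⊗ (c2 ⊗ c3));
  counitL : forall c, \tsum_(c1, c2 <- comul c) (counit c1 *: c2) = c;
  counitR : forall c, \tsum_(c1, c2 <- comul c) (counit c2 *: c1) = c
}.
#[short(type="coalgType")]
HB.structure Definition Coalgebra (k : fieldType) :=
  {C of GRing.Lmodule k C & isCoalgebra k C}.
HB.mixin Record isCocommutative (k : fieldType) C of Coalgebra k C := {
  comulC : forall c : C, \tsum_(c1, c2 <- comul c) (c2 ⊗ c1) = comul c
}.
#[short(type="cocomCoalgType")]
HB.structure Definition CocomCoalgebra (k : fieldType) :=
  {C of Coalgebra k C & isCocommutative k C}.
HB.mixin Record Coalgebra_isHopf (k : fieldType) H of Coalgebra k H & GRing.Algebra k H := {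
  comulM : forall x y : H, comul (x * y) =
    \tsum_(x1, x2 <- comul x) \tsum_(y1, y2 <- comul y) ((x1 * y1) ⊗ (x2 * y2));
  comul1 : comul (1 : H) = 1 ⊗ 1;
  counitM : forall x y : H, counit (x * y) = counit x * counit y;
  counit1 : counit (1 : H) = 1;
  antipode : H -> H;
  antipode_linear : linear antipode;
  antipodeL : forall x, \tsum_(x1, x2 <- comul x) (antipode x1 * x2) = (counit x)%:A;
  antipodeR : forall x, \tsum_(x1, x2 <- comul x) (x1 * antipode x2) = (counit x)%:A
}.
#[short(type="hopfAlgType")]
HB.structure Definition HopfAlgebra (k : fieldType) :=
  {H of GRing.Algebra k H & Coalgebra k H & Coalgebra_isHopf k H}.
#[short(type="cocomHopfAlgType")]
HB.structure Definition CocomHopfAlgebra (k : fieldType) :=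
  {H of HopfAlgebra k H & CocomCoalgebra k H}.

HB.instance Definition _ (k : fieldType) (C : coalgType k) :=
  GRing.isLinear.Build k C (tens C C) *:%R comul comul_linear.
HB.instance Definition _ (k : fieldType) (C : coalgType k) :=
  GRing.isLinear.Build k C k^o *:%R (counit : C -> k^o) counit_linear.

Section Sweedler.
Variables (k : fieldType) (C : coalgType k) (X : lmodType k).

Lemma sw_assoc (F : C -> C -> C -> X) c :
  (forall a b, linear (fun u => F u a b)) ->
  (forall a b, linear (fun u => F a u b)) ->
  (forall a b, linear (fun u => F a b u)) ->
  \tsum_(x, c3 <- comul c) \tsum_(c1, c2 <- comul x) F c1 c2 c3 =
  \tsum_(c1, x <- comul c) \tsum_(c2, c3 <- comul x) F c1 c2 c3.
Proof.
move=> l1 l2 l3; pose G c1 (y : tens C C) := \tsum_(c2, c3 <- y) F c1 c2 c3.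
have lG : bilinear_map G by rewrite /G; lin.
have pG a b d : tsum G (a ⊗ (b ⊗ d)) = F a b d by rewrite tsum_pure // /G tsum_pure //; lin.
have := congr1 (tsum G) (comulA c).
rewrite !tsum_lin; try exact: tsum_linear.
under eq_tsum => a b.
  rewrite tsum_lin; last exact: tsum_linear.
  under eq_tsum => ? ? do rewrite pG.
  over.
move=> ->; apply: eq_tsum => a b.
rewrite tsum_lin; last exact: tsum_linear.
by apply: eq_tsum => ? ?; rewrite pG.
Qed.

Lemma sw_counitL (F : C -> X) c :
  linear F -> \tsum_(c1, c2 <- comul c) (counit c1 *: F c2) = F c.
Proof.
move=> lF; rewrite -[in RHS](counitL c) tsum_lin //.
by apply: eq_tsum => a b; have := lF (counit a) b 0; 
  have := lF (-1) 0 0; rewrite scaler0 !addr0 scaleN1r addNr => ->; rewrite addr0 => ->.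
Qed.
Lemma sw_counitR (F : C -> X) c :
  linear F -> \tsum_(c1, c2 <- comul c) (counit c2 *: F c1) = F c.
Proof.
move=> lF; rewrite -[in RHS](counitR c) tsum_lin //.
by apply: eq_tsum => a b; have := lF (counit b) a 0; 
  have := lF (-1) 0 0; rewrite scaler0 !addr0 scaleN1r addNr => ->; rewrite addr0 => ->.
Qed.
End Sweedler.

Lemma sw_comm (k : fieldType) (C : cocomCoalgType k) (X : lmodType k) (F : C -> C -> X) c :
  bilinear_map F -> \tsum_(c1, c2 <- comul c) F c2 c1 = \tsum_(c1, c2 <- comul c) F c1 c2.
Proof.
move=> bF; rewrite -[in RHS](comulC c) tsum_lin; last exact: tsum_linear.
by apply: eq_tsum => a b; rewrite tsum_pure.
Qed.

Section TensCoalg.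
Variables (k : fieldType) (C D : coalgType k).

Definition tens_comul (t : tens C D) : tens (tens C D) (tens C D) :=
  \tsum_(c, d <- t) \tsum_(c1, c2 <- comul c) \tsum_(d1, d2 <- comul d)
    ((c1 ⊗ d1) ⊗ (c2 ⊗ d2)).
Definition tens_counit (t : tens C D) : k :=
  \tsum_(c, d <- t) (counit c * counit d).

Fact counit2_bilinear : bilinear_map (fun (c : C) (d : D) => counit c * counit d : k^o).
Proof.
split=> w a u v /=.
  have -> : counit (a *: u + v) = a * counit u + counit v by exact: counit_linear.
  by rewrite mulrDl -mulrA.
have -> : counit (a *: u + v) = a * counit u + counit v by exact: counit_linear.
by rewrite mulrDr mulrCA.
Qed.

Lemma tens_comul_linear : linear tens_comul.
Proof. apply: tsum_linear; lin. Qed.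
Lemma tens_counit_linear : linear (tens_counit : tens C D -> k^o).
Proof.
apply: (@tsum_linear _ _ _ k^o); exact: counit2_bilinear.
Qed.
Lemma tens_comul_pure c d : tens_comul (c ⊗ d) =
  \tsum_(c1, c2 <- comul c) \tsum_(d1, d2 <- comul d) ((c1 ⊗ d1) ⊗ (c2 ⊗ d2)).
Proof. by rewrite /tens_comul tsum_pure //; lin. Qed.
Lemma tens_counit_pure c d : tens_counit (c ⊗ d) = counit c * counit d.
Proof.
rewrite /tens_counit (@tsum_pure _ _ _ k^o) //; exact: counit2_bilinear.
Qed.

Lemma sw_tens_ (X : lmodType k) (F : tens C D -> tens C D -> X) c d :
  bilinear_map F ->
  tsum F (tens_comul (c ⊗ d)) =
  \tsum_(c1, c2 <- comul c) \tsum_(d1, d2 <- comul d) F (c1 ⊗ d1) (c2 ⊗ d2).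
Proof.
move=> bF; rewrite tens_comul_pure tsum_lin; last exact: tsum_linear.
apply: eq_tsum => c1 c2; rewrite tsum_lin; last exact: tsum_linear.
by apply: eq_tsum => d1 d2; rewrite tsum_pure.
Qed.

Fact tens_comulA t :
    \tsum_(x, c3 <- tens_comul t) \tsum_(c1, c2 <- tens_comul x) (c1 ⊗ (c2 ⊗ c3)) =
    \tsum_(c1, x <- tens_comul t) \tsum_(c2, c3 <- tens_comul x) (c1 ⊗ (c2 ⊗ c3)).
Proof.
have lt (U : lmodType k) (f : U -> tens C D) :
    linear f -> linear (fun u => tens_comul (f u)).
  by move=> ?; apply: (@lin_app _ _ _ _ tens_comul) => //; exact: tens_comul_linear.
move: t; apply: tens_ind.
- by apply: lin_tsumt; [lin; apply: lt; lin | apply: lt; lin].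
- by apply: lin_tsumt; [lin; apply: lt; lin | apply: lt; lin].
move=> c d; rewrite !sw_tens_; [|by lin; apply: lt; lin..].
transitivity (\tsum_(x, c3 <- comul c) \tsum_(c1, c2 <- comul x)
  \tsum_(y, d3 <- comul d) \tsum_(d1, d2 <- comul y)
  ((c1 ⊗ d1) ⊗ ((c2 ⊗ d2) ⊗ (c3 ⊗ d3)))).
  apply: eq_tsum => c1 c2; rewrite [RHS]exchange_tsum; apply: eq_tsum => d1 d2.
  by rewrite sw_tens_ //; lin.
transitivity (\tsum_(c1, x <- comul c) \tsum_(c2, c3 <- comul x)
  \tsum_(d1, y <- comul d) \tsum_(d2, d3 <- comul y)
  ((c1 ⊗ d1) ⊗ ((c2 ⊗ d2) ⊗ (c3 ⊗ d3)))).
  rewrite sw_assoc; [|by move=> a b; lin..].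
  apply: eq_tsum => c1 c2; apply: eq_tsum => c3 c4.
  by rewrite sw_assoc // => a b; lin.
apply: eq_tsum => c1 c2; rewrite [LHS]exchange_tsum; apply: eq_tsum => d1 d2.
by rewrite sw_tens_ //; lin.
Qed.

Fact tens_counitL t : \tsum_(c1, c2 <- tens_comul t) (tens_counit c1 *: c2) = t.
Proof.
have lt (U : lmodType k) (f : U -> tens C D) :
    linear f -> linear (fun u => tens_comul (f u)).
  by move=> ?; apply: (@lin_app _ _ _ _ tens_comul) => //; exact: tens_comul_linear.
have B : bilinear_map (fun c1 c2 : tens C D => tens_counit c1 *: c2).
  by lin; exact: tens_counit_linear.
move: t; apply: tens_ind; first by apply: lin_tsumt => //; apply: lt; lin.
  exact: lin_id.
move=> c d; rewrite sw_tens_ //.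
under eq_tsum => c1 c2.
  under eq_tsum => d1 d2 do rewrite tens_counit_pure -scalerA.
  rewrite -tsum_lin; last by lin.
  rewrite sw_counitL; last by lin.
  over.
by rewrite sw_counitL; last by lin.
Qed.
Fact tens_counitR t : \tsum_(c1, c2 <- tens_comul t) (tens_counit c2 *: c1) = t.
Proof.
have lt (U : lmodType k) (f : U -> tens C D) :
    linear f -> linear (fun u => tens_comul (f u)).
  by move=> ?; apply: (@lin_app _ _ _ _ tens_comul) => //; exact: tens_comul_linear.
have B : bilinear_map (fun c1 c2 : tens C D => tens_counit c2 *: c1).
  by lin; exact: tens_counit_linear.
move: t; apply: tens_ind; first by apply: lin_tsumt => //; apply: lt; lin.
  exact: lin_id.
move=> c d; rewrite sw_tens_ //.
under eq_tsum => c1 c2.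
  under eq_tsum => d1 d2 do rewrite tens_counit_pure -scalerA.
  rewrite -tsum_lin; last by lin.
  rewrite sw_counitR; last by lin.
  over.
by rewrite sw_counitR; last by lin.
Qed.

HB.instance Definition _ := isCoalgebra.Build k (tens C D)
  tens_comul_linear tens_counit_linear tens_comulA tens_counitL tens_counitR.

Lemma sw_tens (X : lmodType k) (F : tens C D -> tens C D -> X) c d :
  bilinear_map F ->
  tsum F (comul (c ⊗ d)) =
  \tsum_(c1, c2 <- comul c) \tsum_(d1, d2 <- comul d) F (c1 ⊗ d1) (c2 ⊗ d2).
Proof. exact: sw_tens_. Qed.
Lemma counit_pure (c : C) (d : D) : counit (c ⊗ d) = counit c * counit d.
Proof. exact: tens_counit_pure. Qed.
End TensCoalg.

Fact tens_comulC (k : fieldType) (C D : cocomCoalgType k) (t : tens C D) :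
  \tsum_(c1, c2 <- comul t) (c2 ⊗ c1) = comul t.
Proof.
rewrite -[RHS]tsum_pureE.
move: t; apply: tens_ind; [lin | lin | move=> c d].
rewrite !sw_tens; [|lin..].
rewrite -[RHS]sw_comm; last lin.
by apply: eq_tsum => c1 c2; rewrite -[RHS]sw_comm //; lin.
Qed.
HB.instance Definition _ (k : fieldType) (C D : cocomCoalgType k) :=
  isCocommutative.Build k (tens C D) (@tens_comulC k C D).

Definition linear_of (k : fieldType) (V W : lmodType k) (f : V -> W)
    (lf : linear f) : {linear V -> W} :=
  HB.pack_for {linear V -> W} f (GRing.isLinear.Build k V W *:%R f lf).

Section ConvDef.
Variables (k : fieldType) (C : coalgType k) (A : algType k).

(** The convolution algebra; an alias because [{linear C -> A}] is equipped with
    the convolution product. *)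
Definition Hom := {linear C -> A}.
HB.instance Definition _ := gen_eqMixin Hom.
HB.instance Definition _ := gen_choiceMixin Hom.

Lemma HomP (f g : Hom) : (forall c, f c = g c) -> f = g.
Proof.
move=> fg; have E : (f : C -> A) = g by exact/funext.
case: f g E {fg} => f [[a1] [b1]] [g [[a2] [b2]]] /= E; case: _ / E a2 b2 => a2 b2.
by rewrite (Prop_irrelevance a1 a2) (Prop_irrelevance b1 b2).
Qed.
Lemma hom_zero_linear : linear (fun _ : C => 0 : A).
Proof. by move=> a u v; rewrite scaler0 addr0. Qed.
Lemma hom_opp_linear (f : Hom) : linear (fun c => - f c).
Proof. by move=> a u v; rewrite linearP opprD scalerN. Qed.
Lemma hom_add_linear (f g : Hom) : linear (fun c => f c + g c).
Proof. by move=> a u v; rewrite !linearP scalerDr addrACA. Qed.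
Lemma hom_one_linear : linear (fun c : C => (counit c)%:A : A).
Proof. lin. Qed.
Lemma hom_mul_linear (f g : Hom) : linear (fun c => \tsum_(c1, c2 <- comul c) (f c1 * g c2)).
Proof. lin. Qed.
Definition hom_zero : Hom := linear_of hom_zero_linear.
Definition hom_opp f : Hom := linear_of (hom_opp_linear f).
Definition hom_add f g : Hom := linear_of (hom_add_linear f g).
Definition hom_one : Hom := linear_of hom_one_linear.
Definition hom_mul f g : Hom := linear_of (hom_mul_linear f g).

Fact hom_addA : associative hom_add. Proof. by move=> f g h; apply: HomP => c /=; rewrite addrA. Qed.
Fact hom_addC : commutative hom_add. Proof. by move=> f g; apply: HomP => c /=; rewrite addrC. Qed.
Fact hom_add0 : left_id hom_zero hom_add. Proof. by move=> f; apply: HomP => c /=; rewrite add0r. Qed.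
Fact hom_addN : left_inverse hom_zero hom_opp hom_add.
Proof. by move=> f; apply: HomP => c /=; rewrite addNr. Qed.
HB.instance Definition _ := GRing.isZmodule.Build Hom hom_addA hom_addC hom_add0 hom_addN.
Fact hom_mulA : associative hom_mul.
Proof.
move=> f g h; apply: HomP => c /=.
transitivity (\tsum_(c1, x <- comul c) \tsum_(c2, c3 <- comul x) (f c1 * g c2 * h c3)).
  apply: eq_tsum => c1 x; rewrite (@tsum_lin _ _ _ _ _ _ (fun u => f c1 * u)); last by lin.
  by apply: eq_tsum => c2 c3; rewrite mulrA.
rewrite -sw_assoc; [|by move=> a b; lin..].
apply: eq_tsum => x c3; rewrite (@tsum_lin _ _ _ _ _ _ (fun u => u * h c3)) //; by lin.
Qed.
Fact hom_mul1l : left_id hom_one hom_mul.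
Proof.
move=> f; apply: HomP => c /=.
under eq_tsum => a b do rewrite -scalerAl mul1r.
by rewrite sw_counitL //; lin.
Qed.
Fact hom_mul1r : right_id hom_one hom_mul.
Proof.
move=> f; apply: HomP => c /=.
under eq_tsum => a b do rewrite -scalerAr mulr1.
by rewrite sw_counitR //; lin.
Qed.
Fact hom_mulDl : left_distributive hom_mul +%R.
Proof.
move=> f g h; apply: HomP => c /=; rewrite /tsum /eval_tens -big_split /=.
by apply: eq_bigr => p _; rewrite mulrDl.
Qed.
Fact hom_mulDr : right_distributive hom_mul +%R.
Proof.
move=> f g h; apply: HomP => c /=; rewrite /tsum /eval_tens -big_split /=.
by apply: eq_bigr => p _; rewrite mulrDr.
Qed.
HB.instance Definition _ := GRing.Zmodule_isPzRing.Build Hom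
  hom_mulA hom_mul1l hom_mul1r hom_mulDl hom_mulDr.

Lemma HomME (f g : Hom) c : (f * g) c = \tsum_(c1, c2 <- comul c) (f c1 * g c2).
Proof. by []. Qed.
End ConvDef.

Fact hom_mulC (k : fieldType) (C : cocomCoalgType k) (A : comAlgType k) :
  commutative (@hom_mul k C A).
Proof.
move=> f g; apply: HomP => c /=; rewrite -sw_comm; last by lin.
by apply: eq_tsum => a b; rewrite mulrC.
Qed.
HB.instance Definition _ (k : fieldType) (C : cocomCoalgType k) (A : comAlgType k) :=
  GRing.PzRing_hasCommutativeMul.Build (Hom C A) (@hom_mulC k C A).

Section PartialAction.
Variables (k : fieldType) (H : hopfAlgType k) (A : algType k).

Record partial_action := PartialAction {
  pact :> {linear tens H A -> A};
  PA1 : forall a, pact (1 ⊗ a) = a;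
  PA2 : forall h a b, pact (h ⊗ (a * b)) =
    \tsum_(h1, h2 <- comul h) (pact (h1 ⊗ a) * pact (h2 ⊗ b));
  PA3 : forall h l a, pact (h ⊗ pact (l ⊗ a)) =
    \tsum_(h1, h2 <- comul h) (pact (h1 ⊗ 1) * pact ((h2 * l) ⊗ a))
}.
End PartialAction.

Section Cohomology.
Variables (k : fieldType) (H : cocomHopfAlgType k) (A : comAlgType k).
Variable pa : partial_action H A.
Local Notation "h · a" := (pa (h ⊗ a)) (at level 38, right associativity).

Fact e1_linear : linear (fun h => h · 1). Proof. lin. Qed.
Definition e1 : Hom H A := linear_of e1_linear.
Fact e2_linear : linear (fun x : tens H H => \tsum_(h, l <- x) h · l · 1).
Proof. lin. Qed.
Definition e2 : Hom (tens H H) A := linear_of e2_linear.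

(** [C1] and [C2] are the unit groups, with neutral element [e1] (resp. [e2]),
    of the ideals [e1 * Hom H A] and [e2 * Hom (tens H H) A]. *)
Definition in_ideal (C : coalgType k) (e f : Hom C A) : Prop := exists g, f = e * g.
Definition inverse_in (C : coalgType k) (e f g : Hom C A) : Prop :=
  [/\ in_ideal e f, in_ideal e g & f * g = e].
Definition C1 (f : Hom H A) : Prop := exists g, inverse_in e1 f g.
Definition C2 (f : Hom (tens H H) A) : Prop := exists g, inverse_in e2 f g.

Definition cocycle_identity (w : Hom (tens H H) A) : Prop := forall h l m : H,
  \tsum_(h1, h2 <- comul h) \tsum_(l1, l2 <- comul l) \tsum_(m1, m2 <- comul m)
     ((h1 · w (l1 ⊗ m1)) * w (h2 ⊗ (l2 * m2))) =
  \tsum_(h1, h' <- comul h) \tsum_(h2, h3 <- comul h') \tsum_(l1, l2 <- comul l)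
     ((h1 · 1) * w (h2 ⊗ l1) * w ((h3 * l2) ⊗ m)).
Definition Z2 (w : Hom (tens H H) A) : Prop := C2 w /\ cocycle_identity w.

(** [delta1 f g] is the coboundary of [f] when [g] is the inverse of [f] in
    [C1], as required in [B2]. *)
Fact delta1_linear (f g : Hom H A) : linear (fun x : tens H H => 
  \tsum_(h, l <- x)
    \tsum_(h1, h' <- comul h) \tsum_(h2, h3 <- comul h') \tsum_(l1, l2 <- comul l)
       ((h1 · f l1) * g (h2 * l2) * f h3)).
Proof. lin. Qed.
Definition delta1 f g : Hom (tens H H) A := linear_of (delta1_linear f g).

Definition B2 (b : Hom (tens H H) A) : Prop :=
  exists f g, inverse_in e1 f g /\ b = delta1 f g.
(** Equality of the cosets of [w] and [s] modulo the subgroup [B2] *)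
Definition cohomologous (w s : Hom (tens H H) A) : Prop :=
  exists2 b, B2 b & w = s * b.

Structure cocycle2 := Cocycle2 { cocycle_val :> {linear tens H H -> A}; cocycleP : Z2 cocycle_val }.
End Cohomology.

Section CrossedMul.
Variables (k : fieldType) (H : cocomHopfAlgType k) (A : comAlgType k).
Variables (pa : partial_action H A) (w : Hom (tens H H) A).
Local Notation "h · a" := (pa (h ⊗ a)) (at level 38, right associativity).

Definition crossed_mul (s t : tens A H) : tens A H :=
  \tsum_(a, h <- s) \tsum_(b, l <- t)
    \tsum_(h', h3 <- comul h) \tsum_(h1, h2 <- comul h') \tsum_(l1, l2 <- comul l)
       ((a * (h1 · b) * w (h2 ⊗ l1)) ⊗ (h3 * l2)).
Definition lact (a : A) (t : tens A H) : tens A H := \tsum_(b, h <- t) ((a * b) ⊗ h).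
(** The linear extension of a (x) h |-> a # h *)
Definition sharp (t : tens A H) : tens A H :=
  \tsum_(a, h <- t) \tsum_(h1, h2 <- comul h) ((a * (h1 · 1)) ⊗ h2).
End CrossedMul.

Section CrossedTheory.
Variables (k : fieldType) (H : cocomHopfAlgType k) (A : comAlgType k).
Variables (pa : partial_action H A) (w : cocycle2 pa).
Local Notation "h · a" := (pa (h ⊗ a)) (at level 38, right associativity).
Local Notation e1 := (e1 pa).
Local Notation e2 := (e2 pa).
Local Notation HH := (Hom (tens H H) A).
Notation mul := (crossed_mul pa w).

Fact crossed_mul_bilinear : bilinear_map mul.
Proof. by split=> u; rewrite /mul; lin. Qed.
Fact lact_bilinear : bilinear_map (@lact k H A : A -> tens A H -> tens A H).
Proof. by split=> u; rewrite /lact /=; lin. Qed.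
Fact sharp_linear : linear (sharp pa).
Proof. rewrite /sharp; lin. Qed.

Lemma lact_pure (a b : A) (h : H) : lact a (b ⊗ h) = (a * b) ⊗ h.
Proof. by rewrite /lact tsum_pure //; lin. Qed.
Lemma lactA (a b : A) (t : tens A H) : lact a (lact b t) = lact (a * b) t.
Proof.
move: t; apply: tens_ind.
- by apply: lin_app; exact: lact_bilinear.2.
- by exact: lact_bilinear.2.
by move=> c h; rewrite !lact_pure mulrA.
Qed.
Lemma lact1 (t : tens A H) : lact 1 t = t.
Proof.
move: t; apply: tens_ind; [exact: lact_bilinear.2 | exact: lin_id|].
by move=> c h; rewrite lact_pure mul1r.
Qed.

Lemma mul_pure a h b l : mul (a ⊗ h) (b ⊗ l) =
  \tsum_(h', h3 <- comul h) \tsum_(h1, h2 <- comul h') \tsum_(l1, l2 <- comul l)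
       ((a * (h1 · b) * w (h2 ⊗ l1)) ⊗ (h3 * l2)).
Proof. by rewrite /mul tsum_pure ?tsum_pure //; lin. Qed.

Let S h b l := \tsum_(h1, h2 <- comul h) ((h1 · b) * w (h2 ⊗ l)).
Let lS1 b l : linear (fun h => S h b l). Proof. rewrite /S; lin. Qed.
Let lS2 h l : linear (fun b => S h b l). Proof. rewrite /S; lin. Qed.
Let lS3 h b : linear (fun l => S h b l). Proof. rewrite /S; lin. Qed.

Lemma mul_pureS a h b l : mul (a ⊗ h) (b ⊗ l) =
  \tsum_(h', h3 <- comul h) \tsum_(l1, l2 <- comul l) ((a * S h' b l1) ⊗ (h3 * l2)).
Proof.
rewrite mul_pure; apply: eq_tsum => h' h3; rewrite exchange_tsum.
apply: eq_tsum => l1 l2; rewrite /S.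
rewrite (@tsum_lin _ _ _ _ _ _ (fun u => (a * u) ⊗ (h3 * l2))); last by lin.
by apply: eq_tsum => h1 h2; rewrite mulrA.
Qed.

Lemma lact_mul (a : A) s t : mul (lact a s) t = lact a (mul s t).
Proof.
move: s; apply: tens_ind.
- apply: (@lin_app _ _ _ _ (mul^~ t)); [exact: crossed_mul_bilinear.1|exact: lact_bilinear.2].
- apply: (@lin_app _ _ _ _ (lact a)); [exact: lact_bilinear.2|exact: crossed_mul_bilinear.1].
move=> a' h; rewrite lact_pure.
move: t; apply: tens_ind.
- exact: crossed_mul_bilinear.2.
- apply: (@lin_app _ _ _ _ (lact a)); [exact: lact_bilinear.2|exact: crossed_mul_bilinear.2].
move=> b l; rewrite !mul_pureS tsum_lin; last exact: lact_bilinear.2.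
apply: eq_tsum => h' h3; rewrite tsum_lin; last exact: lact_bilinear.2.
by apply: eq_tsum => l1 l2; rewrite lact_pure mulrA.
Qed.

Lemma mul_lact h b t : mul (1 ⊗ h) (lact b t) =
  \tsum_(h1, h2 <- comul h) lact (h1 · b) (mul (1 ⊗ h2) t).
Proof.
have lm s : linear (mul s) by exact: crossed_mul_bilinear.2.
have lml t' : linear (mul^~ t') by exact: crossed_mul_bilinear.1.
have ll a' : linear (@lact k H A a') by exact: lact_bilinear.2.
move: t; apply: tens_ind.
- exact: lin_app.
- by lin; exact: lin_app.
move=> c m; rewrite lact_pure mul_pureS.
transitivity (\tsum_(h', h3 <- comul h) \tsum_(h1, h2 <- comul h')
   \tsum_(m1, m2 <- comul m) (((h1 · b) * S h2 c m1) ⊗ (h3 * m2))); last first.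
  rewrite sw_assoc; [|by move=> ? ?; lin..].
  apply: eq_tsum => h1 h'; rewrite mul_pureS tsum_lin //.
  apply: eq_tsum => h2 h3; rewrite tsum_lin //.
  by apply: eq_tsum => m1 m2; rewrite lact_pure mul1r.
apply: eq_tsum => h' h3; rewrite [RHS]exchange_tsum; apply: eq_tsum => m1 m2.
rewrite -[RHS](@tsum_lin _ _ _ _ _ _ (fun u => u ⊗ (h3 * m2))); last by lin.
congr (_ ⊗ _); rewrite mul1r {1}/S.
transitivity (\tsum_(h'', h5 <- comul h') \tsum_(h1, h2 <- comul h'')
    ((h1 · b) * (h2 · c) * w (h5 ⊗ m1))).
  apply: eq_tsum => h1 h2; rewrite PA2.
  by rewrite (@tsum_lin _ _ _ _ _ _ (fun u => u * w (h2 ⊗ m1))) //; lin.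
rewrite sw_assoc; [|by move=> ? ?; lin..].
apply: eq_tsum => h1 h2; rewrite /S (@tsum_lin _ _ _ _ _ _ (fun u => (h1 · b) * u)); last by lin.
by apply: eq_tsum => h4 h5; rewrite mulrA.
Qed.

Fact f1_linear : linear (fun x : tens H H => \tsum_(h, l <- x) (counit l *: h · 1)).
Proof. lin. Qed.
Let f1 : HH := linear_of f1_linear.
Let f1E h l : f1 (h ⊗ l) = counit l *: h · 1.
Proof. by rewrite /= tsum_pure //; lin. Qed.
Let f1M (g : HH) h l : (f1 * g) (h ⊗ l) = \tsum_(h1, h2 <- comul h) ((h1 · 1) * g (h2 ⊗ l)).
Proof.
rewrite HomME sw_tens; last by lin.
apply: eq_tsum => h1 h2.
under eq_tsum => l1 l2 do rewrite f1E -scalerAl.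
by rewrite sw_counitL //; lin.
Qed.
Let e2E h l : e2 (h ⊗ l) = h · l · 1.
Proof. by rewrite /= tsum_pure //; lin. Qed.
Let f1e2 : f1 * e2 = e2.
Proof.
apply: HomP; apply: tens_ind; [exact: linearP|exact: linearP|move=> h l].
rewrite f1M e2E -[l · 1]mul1r PA2.
by apply: eq_tsum => h1 h2; rewrite e2E.
Qed.
Lemma f1w : f1 * (w : HH) = w.
Proof.
have [[g [[w' ->] _ _]] _] := cocycleP w.
by rewrite mulrA f1e2.
Qed.
Fact q_linear c : linear (fun x : tens H H => \tsum_(h, l <- x) h · l · c).
Proof. lin. Qed.
Let q c : HH := linear_of (q_linear c).
Fact p_linear c : linear (fun x : tens H H => \tsum_(h, l <- x) (h * l) · c).
Proof. lin. Qed.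
Let p c : HH := linear_of (p_linear c).
Fact r_linear m : linear (fun x : tens H H => \tsum_(h, l <- x) w ((h * l) ⊗ m)).
Proof. lin. Qed.
Let r m : HH := linear_of (r_linear m).
Let qE c h l : q c (h ⊗ l) = h · l · c. Proof. by rewrite /= tsum_pure //; lin. Qed.
Let pE c h l : p c (h ⊗ l) = (h * l) · c. Proof. by rewrite /= tsum_pure //; lin. Qed.
Let rE m h l : r m (h ⊗ l) = w ((h * l) ⊗ m). Proof. by rewrite /= tsum_pure //; lin. Qed.
Let q_f1p c : q c = f1 * p c.
Proof.
apply: HomP; apply: tens_ind; [exact: linearP|exact: linearP|move=> h l].
rewrite f1M qE PA3.
by apply: eq_tsum => h1 h2; rewrite pE.
Qed.

Let J h l m : \tsum_(h1, h2 <- comul h) \tsum_(l1, l2 <- comul l) \tsum_(m1, m2 <- comul m)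
     ((h1 · w (l1 ⊗ m1)) * w (h2 ⊗ (l2 * m2))) = ((w : HH) * r m) (h ⊗ l).
Proof.
rewrite (cocycleP w).2 -[in RHS]f1w -mulrA f1M.
apply: eq_tsum => h1 h'; rewrite HomME sw_tens; last by lin.
rewrite (@tsum_lin _ _ _ _ _ _ (fun u => (h1 · 1) * u)); last by lin.
apply: eq_tsum => h2 h3; rewrite (@tsum_lin _ _ _ _ _ _ (fun u => (h1 · 1) * u)); last by lin.
by apply: eq_tsum => l1 l2; rewrite rE mulrA.
Qed.

Let PhiE h l m c :
  \tsum_(l', l3 <- comul l) \tsum_(m1, m2 <- comul m) S h (S l' c m1) (l3 * m2) =
  \tsum_(h1, h2 <- comul h) \tsum_(l1, l2 <- comul l) (w (h1 ⊗ l1) * S (h2 * l2) c m).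
Proof.
have -> : \tsum_(h1, h2 <- comul h) \tsum_(l1, l2 <- comul l) (w (h1 ⊗ l1) * S (h2 * l2) c m)
   = ((w : HH) * (p c * r m)) (h ⊗ l).
  rewrite HomME sw_tens; last by lin.
  apply: eq_tsum => h1 h2; apply: eq_tsum => l1 l2; congr (_ * _).
  rewrite HomME sw_tens; last by lin.
  rewrite /S comulM tsum_lin; last by apply: tsum_linear; lin.
  apply: eq_tsum => h3 h4; rewrite tsum_lin; last by apply: tsum_linear; lin.
  by apply: eq_tsum => l3 l4; rewrite tsum_pure ?pE ?rE //; lin.
have -> : (w : HH) * (p c * r m) = q c * ((w : HH) * r m).
  by rewrite -[in LHS]f1w q_f1p -!mulrA; congr (_ * _); rewrite mulrCA.
rewrite HomME sw_tens; last by lin.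
transitivity (\tsum_(l', l3 <- comul l) \tsum_(l1, l2 <- comul l')
  \tsum_(m1, m2 <- comul m) \tsum_(h', h3 <- comul h) \tsum_(h1, h2 <- comul h')
    ((h1 · l1 · c) * (h2 · w (l2 ⊗ m1)) * w (h3 ⊗ (l3 * m2)))).
  apply: eq_tsum => l' l3; rewrite [RHS]exchange_tsum; apply: eq_tsum => m1 m2.
  rewrite [RHS]exchange_tsum /S; apply: eq_tsum => h' h3.
  rewrite (@tsum_lin _ _ _ _ _ _ (fun u => (h' · u) * w (h3 ⊗ (l3 * m2)))); last by lin.
  apply: eq_tsum => l1 l2; rewrite PA2.
  by rewrite (@tsum_lin _ _ _ _ _ _ (fun u => u * w (h3 ⊗ (l3 * m2)))) //; lin.
rewrite sw_assoc; [|by move=> ? ?; lin..].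
transitivity (\tsum_(l1, l' <- comul l) \tsum_(l2, l3 <- comul l')
  \tsum_(m1, m2 <- comul m) \tsum_(h1, h' <- comul h) \tsum_(h2, h3 <- comul h')
    ((h1 · l1 · c) * (h2 · w (l2 ⊗ m1)) * w (h3 ⊗ (l3 * m2)))).
  apply: eq_tsum => l1 l'; apply: eq_tsum => l2 l3; apply: eq_tsum => m1 m2.
  by rewrite sw_assoc // => ? ?; lin.
rewrite [RHS]exchange_tsum; apply: eq_tsum => l1 l'.
under eq_tsum => l2 l3 do rewrite exchange_tsum.
rewrite exchange_tsum; apply: eq_tsum => h1 h'.
rewrite qE -J (@tsum_lin _ _ _ _ _ _ (fun u => (h1 · l1 · c) * u)); last by lin.
under eq_tsum => l2 l3 do rewrite exchange_tsum.
rewrite exchange_tsum; apply: eq_tsum => h2 h3.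
rewrite (@tsum_lin _ _ _ _ _ _ (fun u => (h1 · l1 · c) * u)); last by lin.
apply: eq_tsum => l2 l3.
rewrite (@tsum_lin _ _ _ _ _ _ (fun u => (h1 · l1 · c) * u)); last by lin.
by apply: eq_tsum => m1 m2; rewrite mulrA.
Qed.

Let lmr s : linear (mul s). Proof. exact: crossed_mul_bilinear.2. Qed.
Let lml t : linear (mul^~ t). Proof. exact: crossed_mul_bilinear.1. Qed.
Let llr a : linear (@lact k H A a). Proof. exact: lact_bilinear.2. Qed.
Let lll t : linear ((@lact k H A)^~ t). Proof. exact: lact_bilinear.1. Qed.

Let mul_mul1 h l z : mul (1 ⊗ h) (mul (1 ⊗ l) z) =
  \tsum_(h1, h2 <- comul h) \tsum_(l1, l2 <- comul l)
     lact (w (h1 ⊗ l1)) (mul (1 ⊗ (h2 * l2)) z).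
Proof.
have B g m' : linear (fun u : H => mul (1 ⊗ (g * u)) m').
  by apply: (@lin_app _ _ _ _ (mul^~ m') (fun u => 1 ⊗ (g * u))) => //; lin.
move: z; apply: tens_ind.
- exact: lin_app.
- by apply: lin_tsumF => h1 h2; apply: lin_tsumF => l1 l2; exact: lin_app.
move=> c m; rewrite mul_pureS tsum_lin //.
transitivity (\tsum_(h', h3 <- comul h) \tsum_(l', l5 <- comul l) \tsum_(m', m4 <- comul m)
   ((\tsum_(l'', l4 <- comul l') \tsum_(m1, m3 <- comul m') S h' (S l'' c m1) (l4 * m3))
     ⊗ (h3 * (l5 * m4)))).
  transitivity (\tsum_(l', l3 <- comul l) \tsum_(m1, m2 <- comul m) \tsum_(h', h3 <- comul h)
     \tsum_(l4, l5 <- comul l3) \tsum_(m3, m4 <- comul m2)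
       (S h' (S l' c m1) (l4 * m3) ⊗ (h3 * (l5 * m4)))).
    apply: eq_tsum => l' l3; rewrite tsum_lin //.
    apply: eq_tsum => m1 m2; rewrite mul_pureS.
    apply: eq_tsum => h' h3; rewrite comulM tsum_lin; last by apply: tsum_linear; lin.
    apply: eq_tsum => l4 l5; rewrite tsum_lin; last by apply: tsum_linear; lin.
    by apply: eq_tsum => m3 m4; rewrite tsum_pure ?mul1r //; lin.
  under eq_tsum => l' l3 do rewrite exchange_tsum.
  rewrite exchange_tsum; apply: eq_tsum => h' h3.
  under eq_tsum => l' l3 do rewrite exchange_tsum.
  rewrite -sw_assoc; [|by move=> ? ?; lin..].
  apply: eq_tsum => l' l5.
  under eq_tsum => l'' l4.
    rewrite -sw_assoc; [|by move=> ? ?; lin..].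
    over.
  rewrite exchange_tsum; apply: eq_tsum => m' m4.
  rewrite (@tsum_lin _ _ _ _ _ _ (fun u => u ⊗ (h3 * (l5 * m4)))); last by lin.
  apply: eq_tsum => l'' l4.
  by rewrite (@tsum_lin _ _ _ _ _ _ (fun u => u ⊗ (h3 * (l5 * m4)))) //; lin.
transitivity (\tsum_(h', h3 <- comul h) \tsum_(l', l3 <- comul l) 
   \tsum_(h1, h2 <- comul h') \tsum_(l1, l2 <- comul l') \tsum_(m1, m2 <- comul m)
   ((w (h1 ⊗ l1) * S (h2 * l2) c m1) ⊗ ((h3 * l3) * m2))).
  apply: eq_tsum => h' h3; apply: eq_tsum => l' l3.
  under [RHS]eq_tsum => h1 h2 do rewrite exchange_tsum.
  rewrite exchange_tsum; apply: eq_tsum => m' m4; rewrite PhiE mulrA.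
  rewrite (@tsum_lin _ _ _ _ _ _ (fun u => u ⊗ (h3 * l3 * m4))); last by lin.
  apply: eq_tsum => h1 h2.
  by rewrite (@tsum_lin _ _ _ _ _ _ (fun u => u ⊗ (h3 * l3 * m4))) //; lin.
under eq_tsum => h' h3 do rewrite exchange_tsum.
rewrite sw_assoc; [|by move=> ? ?; lin..].
apply: eq_tsum => h1 h'.
under eq_tsum => h2 h3.
  rewrite sw_assoc; [|by move=> ? ?; lin..].
  over.
rewrite exchange_tsum; apply: eq_tsum => l1 l'.
have bG : bilinear_map (fun x y : H =>
    \tsum_(m1, m2 <- comul m) ((1 * S x c m1) ⊗ (y * m2))) by lin.
rewrite mul_pureS comulM (tsum_lin _ _ (tsum_linear bG)) tsum_lin //.
apply: eq_tsum => h2 h3; rewrite (tsum_lin _ _ (tsum_linear bG)) tsum_lin //.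
apply: eq_tsum => l2 l3; rewrite (tsum_pure _ _ bG).
rewrite tsum_lin //; apply: eq_tsum => m1 m2.
by rewrite lact_pure mul1r.
Qed.

Lemma crossed_mulA s t z : mul s (mul t z) = mul (mul s t) z.
Proof.
have B m' : linear (fun u : H => mul (1 ⊗ u) m').
  by apply: (@lin_app _ _ _ _ (mul^~ m') (fun u => 1 ⊗ u)) => //; lin.
have Ll (m' : tens A H) (X : lmodType k) (f : X -> A) : linear f -> linear (fun u => lact (f u) m').
  by move=> lf; exact: (lin_app (lll m') lf).
have Lr a (X : lmodType k) (f : X -> tens A H) : linear f -> linear (fun u => lact a (f u)).
  by move=> lf; exact: (lin_app (llr a) lf).
have Bx x m' : linear (fun u : H => mul (1 ⊗ (x * u)) m').
  by apply: (@lin_app _ _ _ _ (fun u => mul u m') (fun u => 1 ⊗ (x * u))) => //; lin.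
have Bx' x m' : linear (fun u : H => mul (1 ⊗ (u * x)) m').
  by apply: (@lin_app _ _ _ _ (fun u => mul u m') (fun u => 1 ⊗ (u * x))) => //; lin.
move: s; apply: tens_ind => //.
  by apply: (@lin_app _ _ _ _ (mul^~ z) (mul^~ t)).
move=> a h; move: t; apply: tens_ind.
- by apply: (@lin_app _ _ _ _ (mul (a ⊗ h)) (mul^~ z)).
- by apply: (@lin_app _ _ _ _ (mul^~ z) (mul (a ⊗ h))).
move=> b l.
have aE : a ⊗ h = lact a (1 ⊗ h) by rewrite lact_pure mulr1.
have bE : b ⊗ l = lact b (1 ⊗ l) by rewrite lact_pure mulr1.
rewrite {1}aE {1}bE !lact_mul mul_lact mul_pure.
transitivity (\tsum_(h1, h' <- comul h) \tsum_(h2, h3 <- comul h') \tsum_(l1, l2 <- comul l)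
  lact a (lact (h1 · b) (lact (w (h2 ⊗ l1)) (mul (1 ⊗ (h3 * l2)) z)))).
  rewrite tsum_lin //; apply: eq_tsum => h1 h'; rewrite mul_mul1.
  rewrite (@tsum_lin _ _ _ _ _ _ (fun u => lact a (lact (h1 · b) u))); last by apply: lin_app.
  apply: eq_tsum => h2 h3.
  by rewrite (@tsum_lin _ _ _ _ _ _ (fun u => lact a (lact (h1 · b) u))); last by apply: lin_app.
rewrite -sw_assoc; last first.
- move=> ? ?; lin; do 3! apply: (Lr) => //; exact: Bx'.
- by move=> ? ?; lin; do 2! apply: (Lr); apply: Ll; lin.
- by move=> ? ?; lin; apply: (Lr); apply: Ll; lin.
rewrite (@tsum_lin _ _ _ _ _ _ (mul^~ z)) //; apply: eq_tsum => h' h3.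
rewrite (@tsum_lin _ _ _ _ _ _ (mul^~ z)) //; apply: eq_tsum => h1 h2.
rewrite (@tsum_lin _ _ _ _ _ _ (mul^~ z)) //; apply: eq_tsum => l1 l2.
by rewrite !lactA -lact_mul lact_pure mulr1.
Qed.

Definition twist (F : Hom H A) (t : tens A H) : tens A H :=
  \tsum_(a, h <- t) \tsum_(h1, h2 <- comul h) ((a * F h1) ⊗ h2).
Fact twist_linear F : linear (twist F). Proof. rewrite /twist; lin. Qed.
Lemma twist_pure F a h :
  twist F (a ⊗ h) = \tsum_(h1, h2 <- comul h) ((a * F h1) ⊗ h2).
Proof. by rewrite /twist tsum_pure //; lin. Qed.
Lemma twistM F G t : twist F (twist G t) = twist (G * F) t.
Proof.
have lF := twist_linear F; have lG := twist_linear G; have lFG := twist_linear (G * F).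
move: t; apply: tens_ind => //; first exact: lin_app.
move=> a h; rewrite !twist_pure tsum_lin //.
transitivity (\tsum_(h1, h' <- comul h) \tsum_(h2, h3 <- comul h')
   ((a * G h1 * F h2) ⊗ h3)).
  by apply: eq_tsum => h1 h'; rewrite twist_pure.
rewrite -sw_assoc; [|by move=> ? ?; lin..].
apply: eq_tsum => h' h3.
rewrite HomME -[LHS](@tsum_lin _ _ _ _ _ _ (fun u => u ⊗ h3)) //; last by lin.
congr (_ ⊗ _); rewrite (@tsum_lin _ _ _ _ _ _ (fun u => a * u)); last by lin.
by apply: eq_tsum => h1 h2; rewrite mulrA.
Qed.

Fact au_linear (b : A) : linear (fun h => h · b). Proof. lin. Qed.
Let au b : Hom H A := linear_of (au_linear b).
Let auM b c : au b * au c = au (b * c).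
Proof. by apply: HomP => h; rewrite HomME /= PA2. Qed.
Let e1E : e1 = au 1. Proof. exact: HomP. Qed.
Lemma sharpE t : sharp pa t = twist e1 t. Proof. by []. Qed.

Fact wl_linear (g : {linear tens H H -> A}) : linear (fun h => g (h ⊗ 1)). Proof. lin. Qed.
Fact wr_linear (g : {linear tens H H -> A}) : linear (fun h => g (1 ⊗ h)). Proof. lin. Qed.
Let wl g : Hom H A := linear_of (wl_linear g).
Let wr g : Hom H A := linear_of (wr_linear g).
Let wlM (f g : HH) : wl (f * g) = wl f * wl g.
Proof.
apply: HomP => h; rewrite !HomME [LHS]/= sw_tens; last by lin.
by apply: eq_tsum => h1 h2; rewrite comul1 tsum_pure //; lin.
Qed.
Let wrM (f g : HH) : wr (f * g) = wr f * wr g.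
Proof.
apply: HomP => h; rewrite !HomME [LHS]/= sw_tens; last by lin.
by rewrite comul1 tsum_pure //; lin.
Qed.
Let wle2 : wl e2 = e1. Proof. by apply: HomP => h; rewrite [LHS]e2E PA1. Qed.
Let wre2 : wr e2 = e1. Proof. by apply: HomP => h; rewrite [LHS]e2E PA1. Qed.

Definition cocycle_inv : {linear tens H H -> A} := sval (cid (cocycleP w).1).
Lemma cocycle_invP : (w : HH) * (cocycle_inv : HH) = e2.
Proof. by have [_ _ ->] := svalP (cid (cocycleP w).1). Qed.

Let e1e1 : e1 * e1 = e1. Proof. by rewrite e1E auM mulr1. Qed.
Let p1E : p 1 * p 1 = p 1.
Proof.
apply: HomP; apply: tens_ind; [exact: linearP|exact: linearP|move=> h l].
rewrite HomME sw_tens; last by lin.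
rewrite pE -[X in _ · X]mulr1 PA2 comulM tsum_lin; last by apply: tsum_linear; lin.
apply: eq_tsum => h1 h2; rewrite tsum_lin; last by apply: tsum_linear; lin.
by apply: eq_tsum => l1 l2; rewrite tsum_pure ?pE //; lin.
Qed.
Let e2q : e2 = q 1. Proof. exact: HomP. Qed.
Let e2p : e2 * p 1 = e2. Proof. by rewrite e2q q_f1p -mulrA p1E. Qed.
Let e2e2 : e2 * e2 = e2.
Proof.
by rewrite {2}e2q q_f1p mulrA [e2 * f1]mulrC f1e2.
Qed.
Let e2w : e2 * (w : HH) = w.
Proof. by have [[g [[w' ->] _ _]] _] := cocycleP w; rewrite mulrA e2e2. Qed.
Let wp1 : (w : HH) * p 1 = w.
Proof. by rewrite -e2w mulrAC e2p. Qed.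
Let u := w (1 ⊗ 1).
Let v := cocycle_inv (1 ⊗ 1).
Let uv : u * v = 1.
Proof.
have : ((w : HH) * (cocycle_inv : HH)) (1 ⊗ 1) = e2 (1 ⊗ 1) by rewrite cocycle_invP.
rewrite e2E !PA1 => <-; rewrite HomME sw_tens; last by lin.
by rewrite comul1 tsum_pure ?tsum_pure //; lin.
Qed.
Let wlw : wl w = au u.
Proof.
have e1wl : e1 * wl w = wl w by rewrite -wle2 -wlM e2w.
have E : au u * wl w = wl w * wl w.
  have -> : wl w * wl w = e1 * (wl w * wl w) by rewrite mulrA e1wl.
  apply: HomP => h; rewrite !HomME.
  have := (cocycleP w).2 h 1 1; rewrite comul1.
  under eq_tsum => h1 h2 do
    (rewrite tsum_pure; [|by lin]; rewrite tsum_pure; [|by lin]; rewrite mulr1).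
  move=> ->; apply: eq_tsum => h1 h'; rewrite HomME.
  rewrite (@tsum_lin _ _ _ _ _ _ (fun u => e1 h1 * u)); last by lin.
  apply: eq_tsum => h2 h3; rewrite tsum_pure; last by lin.
  by rewrite mulr1 mulrA.
have wi : wl w * wl cocycle_inv = e1 by rewrite -wlM cocycle_invP wle2.
have := congr1 (fun f => f * wl cocycle_inv) E; rewrite /= -!mulrA wi.
by rewrite e1E auM mulr1 -e1E mulrC e1wl => ->.
Qed.
Let wrw l : w (1 ⊗ l) = u * (l · 1).
Proof.
have e1wr : e1 * wr w = wr w by rewrite -wre2 -wrM e2w.
have wi : wr w * wr cocycle_inv = e1 by rewrite -wrM cocycle_invP wre2.
have E m : (wr w * wr w) m = u * wr w m.
  have := (cocycleP w).2 1 1 m; rewrite !comul1.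
  do 2! (rewrite tsum_pure; [|by lin]).
  rewrite [RHS]tsum_pure; last by lin.
  rewrite comul1 [RHS]tsum_pure; last by lin.
  rewrite [RHS]tsum_pure; last by lin.
  rewrite mulr1 PA1 mul1r => <-.
  by rewrite HomME; apply: eq_tsum => m1 m2; rewrite PA1 mul1r.
have -> : w (1 ⊗ l) = (wr w * wr w * wr cocycle_inv) l.
  by rewrite -mulrA wi mulrC e1wr.
rewrite HomME; have -> : l · 1 = (wr w * wr cocycle_inv) l by rewrite wi.
rewrite HomME (@tsum_lin _ _ _ _ _ _ (fun x => u * x)); last by lin.
by apply: eq_tsum => m1 m2; rewrite E mulrA.
Qed.

Let Sl1 h b : S h b 1 = (au b * au u) h.
Proof. by rewrite -wlw HomME. Qed.

Let mul_unit t : mul t (1 ⊗ 1) = twist (au u) t.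
Proof.
move: t; apply: tens_ind => //; first exact: twist_linear.
move=> a h; rewrite mul_pureS twist_pure; apply: eq_tsum => h1 h2.
by rewrite comul1 tsum_pure ?Sl1 ?auM ?mul1r ?mulr1 //; lin.
Qed.
Let mulr_one t : mul t (v ⊗ 1) = sharp pa t.
Proof.
move: t; apply: tens_ind => //; first exact: sharp_linear.
move=> a h; rewrite mul_pureS sharpE twist_pure; apply: eq_tsum => h1 h2.
rewrite comul1 tsum_pure; last by lin.
by rewrite Sl1 auM [v * u]mulrC uv -e1E mulr1.
Qed.
Let mull_one t : mul (v ⊗ 1) t = sharp pa t.
Proof.
move: t; apply: tens_ind => //; first exact: sharp_linear.
move=> b l; rewrite mul_pureS sharpE twist_pure comul1 tsum_pure; last by lin.
apply: eq_tsum => l1 l2; rewrite mul1r /S comul1 tsum_pure; last by lin.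
by rewrite PA1 wrw (mulrCA b) !mulrA [v * u]mulrC uv mul1r.
Qed.
Fact fb_linear b : linear (fun x : tens H H => \tsum_(h, l <- x) (counit l *: h · b)).
Proof. lin. Qed.
Let fE b h l : linear_of (fb_linear b) (h ⊗ l) = counit l *: h · b.
Proof. by rewrite /= tsum_pure //; lin. Qed.
Lemma sharp_mul s t : sharp pa (mul s t) = mul s t.
Proof.
move: s; apply: tens_ind => //; first exact: (lin_app sharp_linear (lml t)).
move=> a h; move: t; apply: tens_ind => //; first exact: (lin_app sharp_linear (lmr _)).
move=> b l.
have Sp h0 l0 : \tsum_(h1, h2 <- comul h0) \tsum_(l1, l2 <- comul l0)
    (S h1 b l1 * ((h2 * l2) · 1)) = S h0 b l0.
  pose f : HH := linear_of (fb_linear b).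
  have SE h1 l1 : S h1 b l1 = (f * (w : HH)) (h1 ⊗ l1).
    rewrite HomME sw_tens; last by lin.
    apply: eq_tsum => h2 h3; under eq_tsum => l2 l3 do rewrite fE -scalerAl.
    by rewrite sw_counitL //; lin.
  rewrite SE -wp1 mulrA HomME sw_tens; last by lin.
  by apply: eq_tsum => h1 h2; apply: eq_tsum => l1 l2; rewrite SE pE.
rewrite mul_pureS tsum_lin; last exact: sharp_linear.
transitivity (\tsum_(h', h'' <- comul h) \tsum_(l', l'' <- comul l)
  \tsum_(h3, h4 <- comul h'') \tsum_(l3, l4 <- comul l'')
    ((a * (S h' b l' * ((h3 * l3) · 1))) ⊗ (h4 * l4))).
  apply: eq_tsum => h' h''; rewrite tsum_lin; last exact: sharp_linear.
  apply: eq_tsum => l' l''; rewrite sharpE twist_pure comulM.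
  rewrite tsum_lin; last by apply: tsum_linear; lin.
  apply: eq_tsum => h3 h4; rewrite tsum_lin; last by apply: tsum_linear; lin.
  by apply: eq_tsum => l3 l4; rewrite tsum_pure ?mulrA //; lin.
under eq_tsum => h' h'' do rewrite exchange_tsum.
rewrite -sw_assoc; [|by move=> ? ?; lin..].
apply: eq_tsum => h' h4.
under eq_tsum => h1 h3.
  rewrite -sw_assoc; [|by move=> ? ?; lin..].
  over.
rewrite exchange_tsum; apply: eq_tsum => l' l4.
rewrite -Sp (@tsum_lin _ _ _ _ _ _ (fun x => (a * x) ⊗ (h4 * l4))); last by lin.
apply: eq_tsum => h1 h3.
by rewrite (@tsum_lin _ _ _ _ _ _ (fun x => (a * x) ⊗ (h4 * l4))) //; lin.
Qed.

(** Membership in (A (x) H)(1 (x) 1) *)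
Definition crossed_pred : {pred tens A H} :=
  [pred t | `[< exists s, t = mul s (1 ⊗ 1) >]].
Lemma crossed_predP t : reflect (sharp pa t = t) (t \in crossed_pred).
Proof.
apply: (iffP (asboolP _)) => [[s ->]|<-]; first exact: sharp_mul.
exists (twist (au v) t); rewrite mul_unit twistM auM mulrC uv sharpE.
by congr (twist _ t); exact: e1E.
Qed.

Lemma cocycle_unit : w (1 ⊗ 1) * cocycle_inv (1 ⊗ 1) = 1.
Proof. exact: uv. Qed.
Lemma crossed_mulr1 t : mul t (cocycle_inv (1 ⊗ 1) ⊗ 1) = sharp pa t.
Proof. exact: mulr_one. Qed.
Lemma crossed_mul1r t : mul (cocycle_inv (1 ⊗ 1) ⊗ 1) t = sharp pa t.
Proof. exact: mull_one. Qed.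
Lemma sharp_sharp t : sharp pa (sharp pa t) = sharp pa t.
Proof. by rewrite !sharpE twistM e1e1. Qed.
Lemma sharp_lact (a : A) t : sharp pa (lact a t) = lact a (sharp pa t).
Proof.
move: t; apply: tens_ind; [exact: (lin_app sharp_linear (llr a))|exact: (lin_app (llr a) sharp_linear)|].
move=> b h; rewrite lact_pure !sharpE !twist_pure tsum_lin //.
by apply: eq_tsum => h1 h2; rewrite lact_pure mulrA.
Qed.

Fact crossed_pred_submod : submod_closed crossed_pred.
Proof.
split; first by apply/asboolP; exists 0; rewrite (bil0l _ crossed_mul_bilinear).
move=> a x y /crossed_predP xP /crossed_predP yP; apply/crossed_predP.
by rewrite sharp_linear xP yP.
Qed.
End CrossedTheory.


Section CrossedProduct.
Variables (k : fieldType) (H : cocomHopfAlgType k) (A : comAlgType k).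
Variables (pa : partial_action H A) (w : cocycle2 pa).

HB.instance Definition _ := GRing.isSubmodClosed.Build k (tens A H) (crossed_pred w)
  (crossed_pred_submod w).

Structure crossed := Crossed {
  crossed_val :> tens A H;
  crossed_valP : crossed_val \in crossed_pred w }.
HB.instance Definition _ := [isSub for crossed_val].
HB.instance Definition _ := [Choice of crossed by <:].
HB.instance Definition _ := [SubChoice_isSubLmodule of crossed by <:].

Lemma crossed_valK (x : crossed) : sharp pa x = x.
Proof. exact/crossed_predP/crossed_valP. Qed.

Fact crossed_in s t : crossed_mul pa w s t \in crossed_pred w.
Proof. exact/crossed_predP/sharp_mul. Qed.
Definition crossedM (x y : crossed) : crossed := Crossed (crossed_in x y).
Fact sharp_in t : sharp pa t \in crossed_pred w.
Proof. exact/crossed_predP/sharp_sharp. Qed.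
Definition hash (a : A) (h : H) : crossed := Crossed (sharp_in (a ⊗ h)).
(** Cocycles are not assumed to be normalised, hence the factor w^-1(1, 1). *)
Definition crossed1 : crossed := hash (cocycle_inv w (1 ⊗ 1)) 1.

Lemma crossed1E : val crossed1 = cocycle_inv w (1 ⊗ 1) ⊗ 1.
Proof.
rewrite /= /sharp tsum_pure; last by lin.
by rewrite comul1 tsum_pure ?PA1 ?mulr1 //; lin.
Qed.
Fact crossedMA : associative crossedM.
Proof. by move=> x y z; apply: val_inj; exact: crossed_mulA. Qed.
Fact crossed1l : left_id crossed1 crossedM.
Proof.
move=> x; apply: val_inj; rewrite [LHS]/(crossed_mul pa w (val crossed1) x).
by rewrite crossed1E; exact: etrans (crossed_mul1r w x) (crossed_valK x).
Qed.
Fact crossed1r : right_id crossed1 crossedM.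
Proof.
move=> x; apply: val_inj; rewrite [LHS]/(crossed_mul pa w x (val crossed1)).
by rewrite crossed1E; exact: etrans (crossed_mulr1 w x) (crossed_valK x).
Qed.
Fact crossedZDl (a : k) (x y z : crossed) :
  crossedM (a *: x + y) z = a *: crossedM x z + crossedM y z.
Proof.
apply: val_inj; rewrite [RHS]linearP [LHS]/(crossed_mul pa w (val (a *: x + y)) z).
have -> : val (a *: x + y) = a *: val x + val y by exact: linearP.
exact: (crossed_mul_bilinear w).1.
Qed.
Fact crossedZDr (a : k) (x y z : crossed) :
  crossedM z (a *: x + y) = a *: crossedM z x + crossedM z y.
Proof.
apply: val_inj; rewrite [RHS]linearP [LHS]/(crossed_mul pa w z (val (a *: x + y))).
have -> : val (a *: x + y) = a *: val x + val y by exact: linearP.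
exact: (crossed_mul_bilinear w).2.
Qed.
Fact crossedMDl : left_distributive crossedM +%R.
Proof. by move=> x y z; have := crossedZDl 1 x y z; rewrite !scale1r. Qed.
Fact crossedMDr : right_distributive crossedM +%R.
Proof. by move=> z x y; have := crossedZDr 1 x y z; rewrite !scale1r. Qed.
Fact crossed1_neq0 : crossed1 != 0.
Proof.
apply/eqP => /(congr1 val); rewrite crossed1E linear0.
move=> /(congr1 (tsum (fun a h => counit h *: a))); rewrite tsum_pure; last by lin.
rewrite counit1 scale1r.
have -> : tsum (fun (a : A) (h : H) => counit h *: a) 0 = 0 by apply: tsum0_; lin.
move=> v0; have := cocycle_unit w; rewrite v0 mulr0 => /esym/eqP.
by rewrite oner_eq0.
Qed.
HB.instance Definition _ := GRing.Zmodule_isNzRing.Build crossed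
  crossedMA crossed1l crossed1r crossedMDl crossedMDr crossed1_neq0.
Fact crossedZl (a : k) (x y : crossed) : a *: (x * y) = (a *: x) * y.
Proof.
have : (a *: x + 0) * y = a *: (x * y) + 0 * y by exact: crossedZDl.
by rewrite mul0r !addr0.
Qed.
Fact crossedZr (a : k) (x y : crossed) : a *: (x * y) = x * (a *: y).
Proof.
have : x * (a *: y + 0) = a *: (x * y) + x * 0 by exact: crossedZDr.
by rewrite mulr0 !addr0.
Qed.
HB.instance Definition _ := GRing.Lmodule_isLalgebra.Build k crossed crossedZl.
HB.instance Definition _ := GRing.Lalgebra_isAlgebra.Build k crossed crossedZr.

Fact crossed_lact_in (a : A) (x : crossed) : lact a x \in crossed_pred w.
Proof. by apply/crossed_predP; rewrite sharp_lact crossed_valK. Qed.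
Definition crossed_lact (a : A) (x : crossed) : crossed := Crossed (crossed_lact_in a x).
(** The map a # h |-> a # h_(1) (x) h_(2), see [coaction_hash]; by [hash_span]
    the elements a # h span [crossed]. *)
Definition coaction (x : crossed) : tens crossed H :=
  \tsum_(a, h <- x) \tsum_(h1, h2 <- comul h) (hash a h1 ⊗ h2).

Lemma hash_bilinear : bilinear_map hash.
Proof.
split=> u a x y; apply: val_inj; rewrite [RHS]linearP /=.
  by rewrite tpureDl tpureZl (sharp_linear pa).
by rewrite tpureDr tpureZr (sharp_linear pa).
Qed.
Lemma hash_span (x : crossed) : x = \tsum_(a, h <- x) hash a h.
Proof.
apply: val_inj; rewrite -[LHS]crossed_valK -{1}[crossed_val x]tsum_pureE.
rewrite tsum_lin; last exact: (sharp_linear pa).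
by rewrite (@tsum_lin _ _ _ _ _ _ (val : crossed -> tens A H)); last exact: linearP.
Qed.
Lemma hashE a h : crossed_val (hash a h) =
  \tsum_(h1, h2 <- comul h) ((a * pa (h1 ⊗ 1)) ⊗ h2).
Proof. by rewrite /= /sharp tsum_pure //; lin. Qed.
Lemma crossed_lact_hash a b h : crossed_lact a (hash b h) = hash (a * b) h.
Proof. by apply: val_inj; rewrite /= -sharp_lact lact_pure. Qed.
Lemma coaction_hash a h :
  coaction (hash a h) = \tsum_(h1, h2 <- comul h) (hash a h1 ⊗ h2).
Proof.
have hA l : linear (fun b : A => hash b l) by exact: hash_bilinear.1.
have hH b : linear (fun l : H => hash b l) by exact: hash_bilinear.2.
have hAH b l : linear (fun h0 : H => hash (b * pa (h0 ⊗ 1)) l).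
  by apply: (lin_app (hA l)); lin.
have B : bilinear_map (fun a h => \tsum_(h1, h2 <- comul h) (hash a h1 ⊗ h2)) by lin.
rewrite /coaction hashE tsum_lin; last exact: tsum_linear.
transitivity (\tsum_(h0, h' <- comul h) \tsum_(h1, h2 <- comul h')
  (hash (a * pa (h0 ⊗ 1)) h1 ⊗ h2)).
  by apply: eq_tsum => h0 h'; rewrite tsum_pure.
rewrite -sw_assoc; [|by move=> ? ?; lin..].
apply: eq_tsum => h' h2.
rewrite -(@tsum_lin _ _ _ _ _ _ (fun x : crossed => x ⊗ h2)); last by lin.
congr (_ ⊗ _); apply: val_inj.
transitivity (sharp pa (crossed_val (hash a h'))); last exact: crossed_valK.
rewrite hashE (tsum_lin _ _ (sharp_linear pa)).
by rewrite (@tsum_lin _ _ _ _ _ _ (val : crossed -> tens A H)); last exact: linearP.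
Qed.
End CrossedProduct.

Section CrossedIso.
Variables (k : fieldType) (H : cocomHopfAlgType k) (A : comAlgType k).
Variables (pa : partial_action H A) (w s : cocycle2 pa).
Definition crossed_isomorphic : Prop :=
  exists f : {lrmorphism crossed w -> crossed s},
    [/\ bijective f,
        forall a x, f (crossed_lact a x) = crossed_lact a (f x) &
        forall x, coaction (f x) = \tsum_(y, h <- coaction x) (f y ⊗ h)].
End CrossedIso.

(* Main.v *)
From HB Require Import structures.
From mathcomp Require Import all_boot all_order all_algebra.
Require Import Defs.

Set Implicit Arguments. Unset Strict Implicit. Unset Printing Implicit Defensive.
Import GRing.Theory.
Local Open Scope ring_scope.

(** An isomorphism of crossed products that is left A-linear and right
    H-colinear has to be of the form a # h |-> a u(h_(1)) # h_(2), where u(h) is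
    the A-coefficient of the image of 1 # h: colinearity recovers an element of
    the crossed product from the A-coefficients of its coaction
    ([coaction_coef]), and A-linearity reduces everything to the elements 1 # h
    ([module_comodule_map_twist]). Conversely every u in e_1 * Hom(H, A) gives
    such a module and comodule map ([twist_module_comodule_map]). Composition of
    maps corresponds to convolution of the functions u, so the bijective maps are
    those with u in C^1_par, and the inverse map comes from the inverse of u.

    What remains is multiplicativity. In the commutative convolution algebra
    Hom(H (x) H, A), let L u, M u, T u be the functions u(h) eps(l), u(h l) and
    h . u(l). Each of L, M, T is multiplicative in u. In these terms the product
    of 1 # h and 1 # l has coefficient w ([mul_pure11]), the map given by u
    multiplies this coefficient by M u ([twist_spread]), and multiplying the
    images of 1 # h and 1 # l gives L u * T u * s ([mul_twist]). The map is
    therefore multiplicative exactly when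

       w * M u = L u * T u * s                       ([gauge_equation]).

    Since delta_1(u) = T u * M u^-1 * L u ([delta1E]) and a cocycle absorbs
    M e_1 = M u * M u^-1, that equation says precisely w = s * delta_1(u)
    ([gauge_equationP]). Working in Hom(H (x) H, A) turns all the Sweedler
    computations into commutative algebra. *)

(** * Identities in commutative rings *)

Section RingIdentities.
Variable R : comPzRingType.
Implicit Types a b e l m n s t w x y z : R.

Lemma mul_idem_absorb x y z : y * y = y -> x * y * z * y = x * y * z.
Proof. by move=> yy; rewrite [LHS](ACl (1*(2*4)*3)) /= yy. Qed.

(** Here [m] and [n] are inverse to each other relative to an element [e] that
    fixes both [w] and [s]; for u * v = e_1 these are M u, M v and M e_1. *)
Lemma eq_mul_shift w s l t m n e : m * n = e -> w * e = w -> s * e = s ->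
  w = s * (t * n * l) <-> w * m = l * t * s.
Proof.
move=> mn we se; split=> [-> | E]; last first.
  by rewrite -we -mn mulrA E [LHS](ACl (3*(2*4*1))).
by rewrite !mulrA [LHS](ACl (4*2*1*(5*3))) /= mn -mulrA se.
Qed.

Lemma mul_shift_scaled a b w m l t s :
  w * m = l * t * s -> a * b * w * m = a * l * (b * t) * s.
Proof. by move=> E; rewrite -(mulrA (a * b)) E !mulrA [LHS](ACl (1*3*2*4*5)). Qed.
End RingIdentities.

(** * Functions on H (x) H induced by functions on H *)

Section Pullback.
Variables (k : fieldType) (C D : coalgType k) (A : algType k).

Definition comultiplicative (m : C -> D) : Prop :=
  forall c, comul (m c) = \tsum_(c1, c2 <- comul c) (m c1 ⊗ m c2).

Definition pullback (m : {linear C -> D}) (F : Hom D A) : Hom C A :=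
  linear_of (lin_app (linearP F) (linearP m)).

Lemma pullbackM (m : {linear C -> D}) (F G : Hom D A) :
  comultiplicative m -> pullback m (F * G) = pullback m F * pullback m G.
Proof.
move=> mm; apply: HomP => c; rewrite HomME [LHS]/= mm.
rewrite tsum_lin; last by apply: tsum_linear; lin.
by apply: eq_tsum => c1 c2; rewrite tsum_pure //; lin.
Qed.
End Pullback.

Section CocycleAlgebra.
Variables (k : fieldType) (H : cocomHopfAlgType k) (A : comAlgType k).
Variable pa : partial_action H A.
Local Notation "h · a" := (pa (h ⊗ a)) (at level 38, right associativity).
Local Notation e1 := (e1 pa).
Local Notation e2 := (e2 pa).
Local Notation HH := (Hom (tens H H) A).
Implicit Types F G : Hom H A.

Fact mulH_linear : linear (fun x : tens H H => \tsum_(h, l <- x) (h * l)).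
Proof. lin. Qed.
Definition mulH : {linear tens H H -> H} := linear_of mulH_linear.
Lemma mulHE h l : mulH (h ⊗ l) = h * l.
Proof. by rewrite /= tsum_pure //; lin. Qed.

Fact fst_leg_linear : linear (fun x : tens H H => \tsum_(h, l <- x) (counit l *: h)).
Proof. lin. Qed.
(** The map id (x) eps *)
Definition fst_leg : {linear tens H H -> H} := linear_of fst_leg_linear.
Lemma fst_legE h l : fst_leg (h ⊗ l) = counit l *: h.
Proof. by rewrite /= tsum_pure //; lin. Qed.

Lemma mulH_comul : comultiplicative mulH.
Proof.
apply: tens_ind; [lin|lin|move=> h l].
rewrite mulHE comulM sw_tens; last by lin.
by apply: eq_tsum => h1 h2; apply: eq_tsum => l1 l2; rewrite !mulHE.
Qed.

Lemma fst_leg_comul : comultiplicative fst_leg.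
Proof.
apply: tens_ind; [lin|lin|move=> h l].
rewrite fst_legE sw_tens; last by lin.
have -> : comul (counit l *: h) = counit l *: comul h by exact: linearZ.
rewrite -[in LHS](tsum_pureE (comul h)) [LHS](tsum_lin _ _ (lin_scale (counit l) (@lin_id _ _))).
apply: eq_tsum => h1 h2.
rewrite -(@sw_counitL _ _ _ (fun u => counit u *: (h1 ⊗ h2))); last by lin.
by apply: eq_tsum => l1 l2; rewrite !fst_legE tpureZl tpureZr.
Qed.

Lemma counit_mulH x : counit (mulH x) = counit x.
Proof.
move: x; apply: (@tens_ind _ _ _ k^o); [lin|lin|move=> h l].
by rewrite mulHE counitM counit_pure.
Qed.

(** The operators L, M and T: [ext_left F], [ext_mul F] and [ext_act F] have the
    values F(h) eps(l), F(h l) and h . F(l) at h (x) l. *)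
Definition ext_left F : HH := pullback fst_leg F.
Definition ext_mul F : HH := pullback mulH F.
Fact ext_act_linear F : linear (fun x : tens H H => \tsum_(h, l <- x) h · F l).
Proof. lin. Qed.
Definition ext_act F : HH := linear_of (ext_act_linear F).

Lemma ext_leftE F h l : ext_left F (h ⊗ l) = counit l *: F h.
Proof. by rewrite [LHS](congr1 F (fst_legE h l)) linearZ. Qed.
Lemma ext_mulE F h l : ext_mul F (h ⊗ l) = F (h * l).
Proof. exact: (congr1 F (mulHE h l)). Qed.
Lemma ext_actE F h l : ext_act F (h ⊗ l) = h · F l.
Proof. by rewrite /= tsum_pure //; lin. Qed.

Lemma ext_leftM F G : ext_left (F * G) = ext_left F * ext_left G.
Proof. exact/pullbackM/fst_leg_comul. Qed.
Lemma ext_mulM F G : ext_mul (F * G) = ext_mul F * ext_mul G.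
Proof. exact/pullbackM/mulH_comul. Qed.
(** Axiom (PA2), read in the convolution algebra. *)
Lemma ext_actM F G : ext_act (F * G) = ext_act F * ext_act G.
Proof.
apply: HomP; apply: tens_ind; [exact: linearP|exact: linearP|move=> h l].
rewrite ext_actE [RHS]HomME sw_tens; last by lin.
rewrite [RHS]exchange_tsum HomME (@tsum_lin _ _ _ _ _ _ (fun u => h · u)); last by lin.
apply: eq_tsum => l1 l2; rewrite PA2.
by apply: eq_tsum => h1 h2; rewrite !ext_actE.
Qed.

Lemma ext_left_conv F (g : HH) h l :
  (ext_left F * g) (h ⊗ l) = \tsum_(h1, h2 <- comul h) (F h1 * g (h2 ⊗ l)).
Proof.
rewrite HomME sw_tens; last by lin.
apply: eq_tsum => h1 h2.
under eq_tsum => l1 l2 do rewrite ext_leftE -scalerAl.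
by rewrite sw_counitL //; lin.
Qed.

Lemma e1_idem : e1 * e1 = e1.
Proof. by apply: HomP => h; rewrite HomME /= -PA2 mulr1. Qed.

Lemma e2_ext_act : e2 = ext_act e1.
Proof. exact: HomP. Qed.

(** Axiom (PA3) at the unit of A, read in the convolution algebra. *)
Lemma e2_ext : e2 = ext_left e1 * ext_mul e1.
Proof.
apply: HomP; apply: tens_ind; [exact: linearP|exact: linearP|move=> h l].
by rewrite e2_ext_act ext_actE ext_left_conv PA3; apply: eq_tsum => h1 h2; rewrite ext_mulE.
Qed.

Lemma delta1E F G : delta1 pa F G = ext_act F * ext_mul G * ext_left F.
Proof.
apply: HomP; apply: tens_ind; [exact: linearP|exact: linearP|move=> h l].
rewrite [LHS]/= tsum_pure; last by lin.
rewrite -mulrA HomME sw_tens; last by lin.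
apply: eq_tsum => h1 h'; transitivity (\tsum_(l1, l2 <- comul l)
  \tsum_(h2, h3 <- comul h') ((h1 · F l1) * G (h2 * l2) * F h3)).
  by rewrite exchange_tsum.
apply: eq_tsum => l1 l2; rewrite ext_actE mulrC [ext_mul G * _]mulrC ext_left_conv.
rewrite -sw_comm; last by lin.
rewrite (@tsum_lin _ _ _ _ _ _ (fun u => u * (h1 · F l1))); last by lin.
by apply: eq_tsum => h2 h3; rewrite ext_mulE [RHS]mulrC mulrA mulrAC.
Qed.

Section Cocycle.
Variable w : cocycle2 pa.

(** A cocycle is a multiple of e_2 = L e_1 * M e_1, so it absorbs the two
    idempotents L e_1 and M e_1. *)
Lemma ext_left_e1_cocycle : ext_left e1 * (w : HH) = w.
Proof.
have [[g [[w' ->] _ _]] _] := cocycleP w.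
by rewrite e2_ext !mulrA -ext_leftM e1_idem.
Qed.

Lemma cocycle_ext_mul_e1 : (w : HH) * ext_mul e1 = w.
Proof.
have [[g [[w' ->] _ _]] _] := cocycleP w.
by rewrite e2_ext mul_idem_absorb // -ext_mulM e1_idem.
Qed.
End Cocycle.

(** The condition for a # h |-> a u(h_(1)) # h_(2) to be multiplicative from the
    crossed product of [w] to that of [s]. *)
Definition gauge_equation F (w s : HH) : Prop :=
  w * ext_mul F = ext_left F * ext_act F * s.

(** Multiplying by M v, respectively M u, moves M u across the equation: the
    product M u * M v = M e_1 is absorbed by the cocycle on the other side. *)
Lemma gauge_equationP (w s : cocycle2 pa) u v : u * v = e1 ->
  (w : HH) = (s : HH) * delta1 pa u v <-> gauge_equation u w s.
Proof.
move=> uv; rewrite delta1E; apply: (@eq_mul_shift _ _ _ _ _ _ _ (ext_mul e1)).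
- by rewrite -ext_mulM uv.
- exact: cocycle_ext_mul_e1.
- exact: cocycle_ext_mul_e1.
Qed.
End CocycleAlgebra.

(** * Products of twisted elements *)

Section Spread.
Variables (k : fieldType) (H : cocomHopfAlgType k) (A : comAlgType k).
Variable pa : partial_action H A.
Local Notation HH := (Hom (tens H H) A).
Implicit Types F G : Hom H A.

Let lactl a : linear (@lact k H A a). Proof. exact: (@lact_bilinear k H A).2. Qed.
Let lactr (X : lmodType k) (f : X -> A) t :
  linear f -> linear (fun u => @lact k H A (f u) t).
Proof. by move=> lf; exact: (lin_app ((@lact_bilinear k H A).1 t) lf). Qed.

(** The analogue of [twist] for functions on H (x) H. All products of elements
    1 (x) h and 1 (x) l, twisted or not, have this form, and [coef_spread]
    shows that [G] is determined by the result. *)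
Definition spread (G : HH) (x : tens H H) : tens A H :=
  \tsum_(x1, x2 <- comul x) (G x1 ⊗ mulH H x2).
Fact spread_linear (G : HH) : linear (spread G). Proof. rewrite /spread; lin. Qed.

(** Coassociativity. With [lact] in the right-hand side, factors of a
    convolution product can be peeled off one by one from the left. *)
Lemma spreadM (G K : HH) x :
  spread (G * K) x = \tsum_(x1, x2 <- comul x) lact (G x1) (spread K x2).
Proof.
transitivity (\tsum_(x1, x' <- comul x) \tsum_(x2, x3 <- comul x')
   ((G x1 * K x2) ⊗ mulH H x3)); last first.
  apply: eq_tsum => x1 x'; rewrite (tsum_lin _ _ (lactl _)).
  by apply: eq_tsum => x2 x3; rewrite lact_pure.
rewrite -sw_assoc; [|by move=> ? ?; lin..].
apply: eq_tsum => x' x3; rewrite HomME.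
by rewrite (@tsum_lin _ _ _ _ _ _ (fun u => u ⊗ mulH H x3)) //; lin.
Qed.

(** Holds because [mulH] is a coalgebra map. *)
Lemma twist_spread F (G : HH) x : twist F (spread G x) = spread (G * ext_mul F) x.
Proof.
rewrite (tsum_lin _ _ (twist_linear F)) spreadM; apply: eq_tsum => x1 x2.
rewrite twist_pure mulH_comul tsum_lin; last by apply: tsum_linear; lin.
rewrite (tsum_lin _ _ (lactl _)); apply: eq_tsum => x3 x4.
by rewrite lact_pure tsum_pure //; lin.
Qed.

Lemma twist_lact F a t : twist F (lact a t) = lact a (twist F t).
Proof.
move: t; apply: tens_ind.
- exact: (lin_app (twist_linear F) (lactl a)).
- exact: (lin_app (lactl a) (twist_linear F)).
move=> b h; rewrite lact_pure !twist_pure (tsum_lin _ _ (lactl a)).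
by apply: eq_tsum => h1 h2; rewrite lact_pure mulrA.
Qed.

(** The map id (x) eps: A (x) H -> A. *)
Definition coef (t : tens A H) : A := \tsum_(a, h <- t) (counit h *: a).
Fact coef_linear : linear coef. Proof. rewrite /coef; lin. Qed.
Lemma coef_pure a h : coef (a ⊗ h) = counit h *: a.
Proof. by rewrite /coef tsum_pure //; lin. Qed.

Lemma coef_spread (G : HH) x : coef (spread G x) = G x.
Proof.
rewrite (tsum_lin _ _ coef_linear) -[RHS](@sw_counitR _ _ _ G); last by lin.
by apply: eq_tsum => x1 x2; rewrite coef_pure counit_mulH.
Qed.
Lemma coef_twist F a h : coef (twist F (a ⊗ h)) = a * F h.
Proof.
rewrite twist_pure (tsum_lin _ _ coef_linear).
rewrite -[RHS](@sw_counitR _ _ _ (fun h => a * F h)); last by lin.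
by apply: eq_tsum => h1 h2; rewrite coef_pure.
Qed.

Fact scaled_counit_linear (a : A) : linear (fun h : H => counit h *: a).
Proof. lin. Qed.
(** Writes a (x) h as a twist of 1 (x) h, so that computations with general
    elements reduce to twists of 1 (x) h. *)
Definition scaled_counit a : Hom H A := linear_of (scaled_counit_linear a).
Lemma pure_twist a h : a ⊗ h = twist (scaled_counit a) (1 ⊗ h).
Proof.
rewrite twist_pure -[LHS](@sw_counitL _ _ _ (fun h => a ⊗ h)); last by lin.
by apply: eq_tsum => h1 h2; rewrite mul1r tpureZl.
Qed.

Section Mul.
Variable w : cocycle2 pa.
Local Notation mul := (crossed_mul pa w).
Let mull s : linear (mul s). Proof. exact: (crossed_mul_bilinear w).2. Qed.
Let mulr t : linear (mul^~ t). Proof. exact: (crossed_mul_bilinear w).1. Qed.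

(** The factor h . 1 = e_1(h) in the definition of the product is absorbed by
    the cocycle. *)
Lemma mul_pure11 h l : mul (1 ⊗ h) (1 ⊗ l) = spread w (h ⊗ l).
Proof.
rewrite -[X in spread X]ext_left_e1_cocycle mul_pure /spread sw_tens; last by lin.
apply: eq_tsum => h' h3; rewrite exchange_tsum; apply: eq_tsum => l1 l2.
rewrite ext_left_conv mulHE (@tsum_lin _ _ _ _ _ _ (fun u => u ⊗ (h3 * l2))); last by lin.
by apply: eq_tsum => h1 h2; rewrite mul1r.
Qed.

(** The scalar F(h_(1)) comes out on the left, giving L F. The scalar G(l_(1))
    is acted upon by a leg of h when moved to the left across it, giving T G. *)
Lemma mul_twist F G h l :
  mul (twist F (1 ⊗ h)) (twist G (1 ⊗ l)) =
  spread (ext_left F * ext_act pa G * (w : HH)) (h ⊗ l).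
Proof.
have lS g (X : lmodType k) (f : X -> tens H H) :
    linear f -> linear (fun u => spread g (f u)).
  by move=> lf; exact: (lin_app (spread_linear g) lf).
have lL (X : lmodType k) (f : X -> tens A H) a : linear f -> linear (fun u => lact a (f u)).
  by move=> lf; exact: (lin_app (lactl a) lf).
have mulG h' : mul (1 ⊗ h') (twist G (1 ⊗ l)) = spread (ext_act pa G * (w : HH)) (h' ⊗ l).
  rewrite twist_pure tsum_lin // spreadM sw_tens; last first.
    by split=> x; [apply: lactr; lin|apply: lL; apply: lS; lin].
  rewrite [RHS]exchange_tsum; apply: eq_tsum => l1 l2.
  have -> : (1 * G l1) ⊗ l2 = lact (G l1) (1 ⊗ l2) by rewrite lact_pure mulr1 mul1r.
  rewrite mul_lact; apply: eq_tsum => h1 h2.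
  by rewrite mul_pure11 ext_actE.
rewrite -mulrA spreadM sw_tens; last first.
  by split=> x; [apply: lactr; lin|apply: lL; apply: lS; lin].
rewrite twist_pure (tsum_lin _ _ (mulr _)); apply: eq_tsum => h1 h2.
have -> : (1 * F h1) ⊗ h2 = lact (F h1) (1 ⊗ h2) by rewrite lact_pure mulr1 mul1r.
rewrite lact_mul mulG.
rewrite -[LHS](@sw_counitL _ _ _ (fun l => lact (F h1) (spread _ (h2 ⊗ l)))); last first.
  by apply: lL; apply: lS; lin.
apply: eq_tsum => l1 l2; rewrite ext_leftE.
exact/esym/(scalable_linear (lactr _ (@lin_id _ A))).
Qed.

(** [sharp] is multiplication by w^-1(1, 1) (x) 1, so associativity moves it
    onto the product, where it acts trivially. *)
Lemma mul_sharpr s t : mul s (sharp pa t) = mul s t.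
Proof. by rewrite -(crossed_mulr1 w t) crossed_mulA crossed_mulr1 sharp_mul. Qed.
Lemma mul_sharpl s t : mul (sharp pa s) t = mul s t.
Proof. by rewrite -(crossed_mul1r w s) -crossed_mulA crossed_mul1r sharp_mul. Qed.
End Mul.

(** On pure tensors a (x) h and b (x) l, both sides are spreads, of
    L a * T b * w * M u and L a * L u * T b * T u * s (a and b standing for their
    scaled counits). *)
Lemma twist_mul (w s : cocycle2 pa) u x y : gauge_equation pa u w s ->
  twist u (crossed_mul pa w x y) = crossed_mul pa s (twist u x) (twist u y).
Proof.
have lm (v : cocycle2 pa) := crossed_mul_bilinear v; have lt := twist_linear u.
move=> us; move: x; apply: tens_ind.
- exact: (lin_app lt ((lm w).1 y)).
- exact: (lin_app ((lm s).1 (twist u y)) lt).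
move=> a h; move: y; apply: tens_ind.
- exact: (lin_app lt ((lm w).2 (a ⊗ h))).
- exact: (lin_app ((lm s).2 (twist u (a ⊗ h))) lt).
move=> b l; rewrite (pure_twist a h) (pure_twist b l) !twistM !mul_twist twist_spread.
congr (spread _ _).
rewrite ext_leftM ext_actM; exact: mul_shift_scaled.
Qed.

(** Comparison of coefficients in the spreads of w * M u and L u * T u * s. *)
Lemma twist_mul_gauge_equation (w s : cocycle2 pa) u :
  (forall h l, twist u (crossed_mul pa w (1 ⊗ h) (1 ⊗ l)) =
     crossed_mul pa s (twist u (1 ⊗ h)) (twist u (1 ⊗ l))) ->
  gauge_equation pa u w s.
Proof.
move=> us; apply: HomP; apply: tens_ind; [exact: linearP|exact: linearP|move=> h l].
by rewrite -coef_spread -twist_spread -mul_pure11 us mul_twist coef_spread.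
Qed.
End Spread.

(** * Module and comodule maps between crossed products *)

Section CrossedMaps.
Variables (k : fieldType) (H : cocomHopfAlgType k) (A : comAlgType k).
Variable pa : partial_action H A.
Local Notation e1 := (e1 pa).
Implicit Types (u v F : Hom H A) (w s : cocycle2 pa).

Let hash_linearl w l : linear (fun b : A => hash w b l).
Proof. exact: (hash_bilinear w).1. Qed.
Let hash_linearr w b : linear (fun l : H => hash w b l).
Proof. exact: (hash_bilinear w).2. Qed.
Let crossed_coef_linear w : linear (fun y : crossed w => coef y).
Proof. exact: (lin_app (@coef_linear k H A) (linearP (val : crossed w -> tens A H))). Qed.
Let coef_bilinear w : bilinear_map (fun (y : crossed w) h => hash w (coef y) h).
Proof.
split=> z; last exact: hash_linearr.
by apply: (lin_app (@hash_linearl w z)); exact: crossed_coef_linear.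
Qed.

Definition module_comodule_map w s (f : crossed w -> crossed s) : Prop :=
  [/\ linear f, forall a x, f (crossed_lact a x) = crossed_lact a (f x) &
      forall x, coaction (f x) = \tsum_(y, h <- coaction x) (f y ⊗ h)].

(** The elements a # h span the crossed product. *)
Lemma crossed_linear_ext w (X : lmodType k) (f g : crossed w -> X) :
  linear f -> linear g -> (forall a h, f (hash w a h) = g (hash w a h)) -> f =1 g.
Proof.
move=> lf lg fg x; rewrite [x]hash_span !tsum_lin //.
exact: eq_tsum.
Qed.

Lemma coaction_linear w : linear (@coaction k H A pa w).
Proof.
have hA := @hash_linearl w; have hH := @hash_linearr w.
apply: (lin_app (tsum_linear _) (linearP (val : crossed w -> tens A H))); lin.
Qed.

Lemma sharp_twist u t : e1 * u = u -> sharp pa (twist u t) = twist u t.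
Proof. by move=> eu; rewrite sharpE twistM mulrC eu. Qed.
Lemma twist_sharp u t : e1 * u = u -> twist u (sharp pa t) = twist u t.
Proof. by move=> eu; rewrite sharpE twistM eu. Qed.

Lemma twist_hash w s u a h : e1 * u = u ->
  twist u (hash w a h) = \tsum_(h1, h2 <- comul h) hash s (a * u h1) h2.
Proof.
move=> eu; rewrite twist_sharp // -(sharp_twist _ eu) twist_pure.
rewrite (tsum_lin _ _ (sharp_linear pa)).
by rewrite (@tsum_lin _ _ _ _ _ _ (val : crossed s -> tens A H)); last exact: linearP.
Qed.

(** Colinearity comes from coassociativity: both sides send a # h to
    a u(h_(1)) # h_(2) (x) h_(3). *)
Lemma twist_module_comodule_map w s u (f : crossed w -> crossed s) : e1 * u = u ->
  (forall x, crossed_val (f x) = twist u x) -> module_comodule_map f.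
Proof.
move=> eu fE; have lf : linear f.
  move=> a x y; apply: val_inj; rewrite [RHS]linearP /= !fE.
  exact: twist_linear.
have hA := @hash_linearl s; have hH := @hash_linearr s.
have fh a h : f (hash w a h) = \tsum_(h1, h2 <- comul h) hash s (a * u h1) h2.
  by apply: val_inj; rewrite [LHS]fE (twist_hash w s a h eu).
have lfp (X : lmodType k) (g : X -> tens (crossed w) H) : linear g ->
    linear (fun x => \tsum_(y, h <- g x) (f y ⊗ h)).
  by move=> lg; apply: lin_tsumt => //; lin.
split=> // [a x|]; first by apply: val_inj; rewrite [LHS]fE /= fE twist_lact.
apply: crossed_linear_ext; [exact: (lin_app (@coaction_linear s) lf)
                          |exact: (lfp _ _ (@coaction_linear w))|move=> a h].
rewrite fh coaction_hash (tsum_lin _ _ (@coaction_linear s)).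
rewrite (tsum_lin _ _ (tsum_linear _)); last by lin.
transitivity (\tsum_(h1, h' <- comul h) \tsum_(h2, h3 <- comul h')
    (hash s (a * u h1) h2 ⊗ h3)).
  by apply: eq_tsum => h1 h'; rewrite coaction_hash.
have hAH c l : linear (fun h0 : H => hash s (c * u h0) l).
  by apply: (lin_app (hA l)); lin.
rewrite -sw_assoc; [|by move=> ? ?; lin..].
apply: eq_tsum => h' h3; rewrite tsum_pure; last by lin.
by rewrite fh (@tsum_lin _ _ _ _ _ _ (fun x : crossed s => x ⊗ h3)) //; lin.
Qed.

Lemma coef_hash w a h : coef (hash w a h) = a * e1 h.
Proof. by rewrite -coef_twist. Qed.

(** Applying [coef] to the left legs of the coaction of a # h gives
    a (h_(1) . 1) # h_(2), which is a # h again. *)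
Lemma coaction_coef w (x : crossed w) :
  x = tsum (fun (y : crossed w) h => hash w (coef y) h) (coaction x).
Proof.
have B := coef_bilinear w.
move: x; apply: crossed_linear_ext; first exact: lin_id.
  exact: (lin_tsumt B (@coaction_linear w)).
move=> a h; rewrite coaction_hash (tsum_lin _ _ (tsum_linear B)).
apply: val_inj; rewrite -[LHS](crossed_valK (hash w a h)) sharpE.
rewrite (twist_hash w w a h (e1_idem pa)); congr crossed_val.
by apply: eq_tsum => h1 h2; rewrite tsum_pure // coef_hash.
Qed.

(** Colinearity and [coaction_coef] give f(1 # h) = u(h_(1)) # h_(2), where u(h)
    is the A-coefficient of f(1 # h); A-linearity extends this to a # h. *)
Lemma module_comodule_map_twist w s (f : crossed w -> crossed s) : module_comodule_map f ->
  exists2 u, e1 * u = u & forall x, crossed_val (f x) = twist u x.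
Proof.
case=> lf fA fH.
have lu : linear (fun h => coef (f (hash w 1 h))).
  exact: (lin_app (@crossed_coef_linear s) (lin_app lf ((hash_bilinear w).2 1))).
pose u : Hom H A := linear_of lu.
have B := coef_bilinear s.
have Bf : bilinear_map (fun (y : crossed w) (h : H) => f y ⊗ h).
  by split=> z; [apply: lin_purel | apply: lin_purer; exact: lin_id].
have f1 h : f (hash w 1 h) = \tsum_(h1, h2 <- comul h) hash s (u h1) h2.
  rewrite [LHS]coaction_coef fH coaction_hash (tsum_lin _ _ (tsum_linear Bf)).
  rewrite (tsum_lin _ _ (tsum_linear B)); apply: eq_tsum => h1 h2.
  by rewrite !tsum_pure.
have eu : e1 * u = u.
  apply: HomP => h; rewrite mulrC HomME [RHS](congr1 (fun y : crossed s => coef y) (f1 h)).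
  by rewrite (tsum_lin _ _ (@crossed_coef_linear s)); apply: eq_tsum => h1 h2; rewrite coef_hash.
exists u => //; apply: crossed_linear_ext.
- exact: (lin_app (linearP (val : crossed s -> tens A H)) lf).
- exact: (lin_app (twist_linear u) (linearP (val : crossed w -> tens A H))).
move=> a h; rewrite (twist_hash w s a h eu).
have -> : hash w a h = crossed_lact a (hash w 1 h) by rewrite crossed_lact_hash mulr1.
have ll : linear (crossed_lact a : crossed s -> crossed s).
  move=> b x y; apply: val_inj; rewrite [RHS]linearP /=.
  by rewrite -(@lact_bilinear k H A).2.
rewrite fA f1 (tsum_lin _ _ ll); congr crossed_val.
by apply: eq_tsum => h1 h2; rewrite crossed_lact_hash.
Qed.

Lemma module_comodule_map_inv w s (f : crossed w -> crossed s) (g : crossed s -> crossed w) :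
  cancel f g -> cancel g f -> module_comodule_map f -> module_comodule_map g.
Proof.
move=> fK gK [lf fA fH].
have lg : linear g.
  by move=> a x y; apply: (can_inj fK); rewrite lf !gK.
have B : bilinear_map (fun (y : crossed s) (h : H) => g y ⊗ h).
  by split=> z; [apply: lin_purel | apply: lin_purer; exact: lin_id].
split=> // [a x|x]; first by apply: (can_inj fK); rewrite fA !gK.
rewrite -[in RHS](gK x) fH (tsum_lin _ _ (tsum_linear B)) -[LHS]tsum_pureE.
by apply: eq_tsum => y h; rewrite tsum_pure // fK.
Qed.

(** In one direction the function v comes from the inverse isomorphism; in the
    other, the maps given by u and v are mutually inverse and multiplicative, and
    a bijective multiplicative map preserves the unit. *)
Lemma crossed_isomorphicP w s : crossed_isomorphic w s <->
  exists u v, inverse_in e1 u v /\ gauge_equation pa u w s.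
Proof.
split=> [[f [[g fK gK] fA fH]]|[u [v [[[u' uE] [v' vE] uv] us]]]].
  have fM : module_comodule_map f by split=> //; exact: linearP.
  have [u eu fE] := module_comodule_map_twist fM.
  have [v ev gE] := module_comodule_map_twist (module_comodule_map_inv fK gK fM).
  exists u, v; split; last first.
    apply: twist_mul_gauge_equation => h l.
    have := congr1 val (rmorphM f (hash w 1 h) (hash w 1 l)); rewrite [LHS]fE.
    rewrite [LHS](congr1 (twist u) (erefl (crossed_mul pa w (hash w 1 h) (hash w 1 l)))).
    (* 1 # h is [sharp] of 1 (x) h, and [sharp] disappears inside products *)
    rewrite [X in twist u X](mul_sharpr w) (mul_sharpl w) => ->.
    rewrite [LHS](_ : _ = crossed_mul pa s (f (hash w 1 h)) (f (hash w 1 l))) //.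
    by rewrite !fE !twist_sharp.
  split; [by exists u; rewrite eu|by exists v; rewrite ev|].
  apply: HomP => h; have : coef (g (f (hash w 1 h))) = coef (hash w 1 h) by rewrite fK.
  by rewrite gE fE twistM twist_sharp ?mulrA ?eu // coef_twist coef_hash !mul1r.
have eu : e1 * u = u by rewrite uE mulrA e1_idem.
have ev : e1 * v = v by rewrite vE mulrA e1_idem.
have twist_in F w' (x : tens A H) : e1 * F = F -> twist F x \in crossed_pred w'.
  by move=> eF; apply/crossed_predP/sharp_twist.
pose f (x : crossed w) : crossed s := Crossed (twist_in _ _ x eu).
pose g (x : crossed s) : crossed w := Crossed (twist_in _ _ x ev).
have [lf fA fH] : module_comodule_map f by exact: (twist_module_comodule_map eu).
have fK : cancel f g.
  by move=> x; apply: val_inj; rewrite /= twistM uv; exact: crossed_valK.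
have gK : cancel g f.
  by move=> x; apply: val_inj; rewrite /= twistM mulrC uv; exact: crossed_valK.
have fM x y : f (x * y) = f x * f y by apply: val_inj; exact: twist_mul.
have f1 : f 1 = 1 by rewrite -[LHS]mulr1 -[in LHS](gK 1) -fM mul1r gK.
pose F := HB.pack_for {lrmorphism crossed w -> crossed s} f
  (GRing.isLinear.Build k _ _ *:%R f lf)
  (GRing.isMonoidMorphism.Build _ _ f (f1, fM)).
by exists F; split=> //; exists g.
Qed.
End CrossedMaps.

Theorem theorem5p7 (k : fieldType) (H : cocomHopfAlgType k) (A : comAlgType k)
    (pa : partial_action H A) (omega sigma : cocycle2 pa) :
  crossed_isomorphic omega sigma <-> cohomologous pa omega sigma.
Proof.
split=> [/crossed_isomorphicP[u [v [uv us]]]|[b [u [v [uv ->]]] wE]].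
  have [_ _ uvE] := uv; exists (delta1 pa u v); first by exists u, v.
  exact/(gauge_equationP omega sigma uvE).
have [_ _ uvE] := uv; apply/crossed_isomorphicP; exists u, v; split=> //.
exact/(gauge_equationP omega sigma uvE).
Qed.
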